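(* Let $n$ be a fixed nonzero integer. If a quadratic equation $W=1$ over $BS(1,n)$ has a solution, then it has a solution of size $O(|W|^3)$; that is, there is a constant $C=C(n)$ such that every quadratic equation $W=1$ over $BS(1,n)$ that has a solution has a solution of size at most $C|W|^3$.
   Context: $BS(1,n)=\langle a,t\mid t^{-1}at=a^n\rangle$. Let $F$ be the free group on variables $z_1,\dots,z_k$. An equation over a group $G$ is an expression $W=1$ with $W\in F*G$ (all $z_i$ are assumed to appear in $W$). A solution is a tuple $(g_1,\dots,g_k)\in G^k$ such that the homomorphism $F*G\to G$ that is the identity on $G$ and sends $z_i\mapsto g_i$ maps $W$ to $1$. The equation is quadratic if each variable appears exactly twice in $W$ (each time as $z_i$ or $z_i^{-1}$). $W$ is given as a freely reduced word in the variables $z_i$ and the generators $a,t$ (and inverses), and $|W|$ is its word length. The size of a solution $(g_1,\dots,g_k)$ is $\sum_{i=1}^k|g_i|$, where $|g|$ is the geodesic word length of $g\in BS(1,n)$ with respect to $\{a,t\}$. *)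

(* Defs.v *)
From HB Require Import structures.
From mathcomp Require Import all_boot ssralg ssrnum ssrint.
From mathcomp Require Import boolp.

Set Implicit Arguments.
Unset Strict Implicit.
Unset Printing Implicit Defensive.

Local Open Scope group_scope.
Local Open Scope quotient_scope.

(* Words over an alphabet X and its formal inverses: the letter (x, true)
   stands for x, and (x, false) stands for x^-1. *)
Notation word X := (seq (X * bool)).

Definition inv_letter (X : Type) (l : X * bool) : X * bool := (l.1, ~~ l.2).

Definition inv_word (X : Type) (w : word X) : word X :=
  rev (map (@inv_letter X) w).

Definition freely_reduced (X : eqType) (w : word X) : bool :=
  sorted (fun l m => m != inv_letter l) w.

Definition eval_word (X : Type) (G : groupType) (f : X -> G) (w : word X) : G :=
  \prod_(l <- w) (if l.2 then f l.1 else (f l.1)^-1).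

Inductive bs_gen := gen_a | gen_t.

Definition bool_of_bs_gen (x : bs_gen) : bool :=
  if x is gen_a then true else false.
Definition bs_gen_of_bool (b : bool) : bs_gen := if b then gen_a else gen_t.
Lemma bool_of_bs_genK : cancel bool_of_bs_gen bs_gen_of_bool.
Proof. by case. Qed.
HB.instance Definition _ := Countable.copy bs_gen (can_type bool_of_bs_genK).

Notation bs_word := (word bs_gen).

(* The smallest congruence on words that contains the free cancellations and
   t^-1 a t = a^n; for n < 0, the right-hand side is the word of `|n|
   letters a^-1. *)
Inductive bs_eqv (n : int) : bs_word -> bs_word -> Prop :=
| bs_eqv_refl u : bs_eqv n u u
| bs_eqv_sym u v : bs_eqv n u v -> bs_eqv n v u
| bs_eqv_trans u v w : bs_eqv n u v -> bs_eqv n v w -> bs_eqv n u w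
| bs_eqv_cat u u' v v' :
    bs_eqv n u u' -> bs_eqv n v v' -> bs_eqv n (u ++ v) (u' ++ v')
| bs_eqv_cancel l : bs_eqv n [:: l; inv_letter l] [::]
| bs_eqv_rel :
    bs_eqv n [:: (gen_t, false); (gen_a, true); (gen_t, true)]
             (nseq `|n|%N (gen_a, (0 <= n)%R)).

Definition bs_eqb (n : int) : rel bs_word := fun u v => `[< bs_eqv n u v >].

Lemma bs_eqb_is_equiv (n : int) : equiv_class_of (bs_eqb n).
Proof.
split=> [u|u v|v u w].
- by apply/asboolP; exact: bs_eqv_refl.
- by apply/asboolP/asboolP; exact: bs_eqv_sym.
- by move=> /asboolP uv /asboolP vw; apply/asboolP; exact: bs_eqv_trans uv vw.
Qed.

Canonical bs_equiv_rel (n : int) := EquivRelPack (bs_eqb_is_equiv n).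

Definition BS (n : int) : Type := {eq_quot bs_eqb n}.
HB.instance Definition _ (n : int) := Choice.on (BS n).
HB.instance Definition _ (n : int) := EqQuotient.on (BS n).

Lemma BS_eqP (n : int) (u v : bs_word) :
  \pi_(BS n) u = \pi_(BS n) v <-> bs_eqv n u v.
Proof.
by split=> [/eqquotP/asboolP//|uv]; apply/eqquotP/asboolP.
Qed.

Lemma bs_eqv_wordV (n : int) (u : bs_word) : bs_eqv n (u ++ inv_word u) [::].
Proof.
elim: u => [|l u IHu]; first exact: bs_eqv_refl.
rewrite /inv_word /= rev_cons -cats1 catA.
apply: bs_eqv_trans (bs_eqv_cancel n l).
have IHl := bs_eqv_cat IHu (bs_eqv_refl n [:: inv_letter l]).
exact: bs_eqv_cat (bs_eqv_refl n [:: l]) IHl.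
Qed.

Lemma inv_wordK (X : Type) : involutive (@inv_word X).
Proof.
move=> w; rewrite /inv_word map_rev revK -map_comp -[RHS]map_id.
by apply: eq_map => -[x b]; rewrite /= /inv_letter /= negbK.
Qed.

Lemma bs_eqv_Vword (n : int) (u : bs_word) : bs_eqv n (inv_word u ++ u) [::].
Proof. by rewrite -{2}[u]inv_wordK; exact: bs_eqv_wordV. Qed.

Definition BS_one (n : int) : BS n := \pi_(BS n) [::].
Definition BS_mul (n : int) (x y : BS n) : BS n := \pi_(BS n) (repr x ++ repr y).
Definition BS_inv (n : int) (x : BS n) : BS n := \pi_(BS n) (inv_word (repr x)).

Lemma BS_mul_pi (n : int) (u v : bs_word) :
  BS_mul (\pi_(BS n) u) (\pi_(BS n) v) = \pi_(BS n) (u ++ v).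
Proof. by apply/BS_eqP/bs_eqv_cat; apply/BS_eqP; rewrite reprK. Qed.

Lemma BS_mulA (n : int) : associative (@BS_mul n).
Proof.
elim/quotW=> u; elim/quotW=> v; elim/quotW=> w.
rewrite (BS_mul_pi n v w) (BS_mul_pi n u v) (BS_mul_pi n u (v ++ w)).
by rewrite (BS_mul_pi n (u ++ v) w) catA.
Qed.

Lemma BS_mul1g (n : int) : left_id (BS_one n) (@BS_mul n).
Proof. by move=> x; rewrite -[x]reprK BS_mul_pi. Qed.

Lemma BS_mulg1 (n : int) : right_id (BS_one n) (@BS_mul n).
Proof. by move=> x; rewrite -[x]reprK BS_mul_pi cats0. Qed.

Lemma BS_mulVg (n : int) : left_inverse (BS_one n) (@BS_inv n) (@BS_mul n).
Proof.
move=> x; rewrite -{2}[x]reprK BS_mul_pi.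
by apply/BS_eqP; exact: bs_eqv_Vword.
Qed.

Lemma BS_mulgV (n : int) : right_inverse (BS_one n) (@BS_inv n) (@BS_mul n).
Proof.
move=> x; rewrite -{1}[x]reprK BS_mul_pi.
by apply/BS_eqP; exact: bs_eqv_wordV.
Qed.

HB.instance Definition _ (n : int) :=
  isGroup.Build (BS n) (@BS_mulA n) (@BS_mul1g n) (@BS_mulg1 n)
    (@BS_mulVg n) (@BS_mulgV n).

Definition BS_gen (n : int) (x : bs_gen) : BS n := \pi_(BS n) [:: (x, true)].

Lemma eval_word_BS (n : int) (u : bs_word) :
  eval_word (BS_gen n) u = \pi_(BS n) u.
Proof.
elim: u => [|[x b] u IHu]; rewrite /eval_word ?big_nil ?big_cons //=.
rewrite -/(eval_word _ _) IHu -cat1s -[RHS]BS_mul_pi; congr (_ * _).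
case: b => //; apply/(mulgI (BS_gen n x)); rewrite mulgV.
rewrite [RHS]BS_mul_pi; apply/esym/BS_eqP.
exact: (bs_eqv_cancel n (x, true)).
Qed.

Definition is_word_length (n : int) (g : BS n) (m : nat) : bool :=
  `[< exists2 u : bs_word, eval_word (BS_gen n) u = g & size u = m >].

Lemma is_word_length_ex (n : int) (g : BS n) : exists m, is_word_length g m.
Proof.
exists (size (repr g)); apply/asboolP; exists (repr g) => //.
by rewrite eval_word_BS reprK.
Qed.

Definition geodesic_length (n : int) (g : BS n) : nat :=
  ex_minn (is_word_length_ex g).

(* The symbols of an equation in k variables: inl i is the variable z_i,
   inr x is a generator of BS(1,n). *)
Definition eq_symbol (k : nat) : Type := ('I_k + bs_gen)%type.
HB.instance Definition _ (k : nat) := Equality.on (eq_symbol k).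

(* The image of a symbol under the homomorphism F * G -> G that is the
   identity on G and sends z_i to g_i. *)
Definition eq_subst (n : int) (k : nat) (g : k.-tuple (BS n))
    (s : eq_symbol k) : BS n :=
  match s with inl i => tnth g i | inr x => BS_gen n x end.

Definition is_solution (n : int) (k : nat) (W : word (eq_symbol k))
    (g : k.-tuple (BS n)) : Prop :=
  eval_word (eq_subst g) W = 1.

Definition quadratic (k : nat) (W : word (eq_symbol k)) : Prop :=
  forall i : 'I_k, count (fun l => l.1 == inl i :> eq_symbol k) W = 2.

Definition solution_size (n : int) (k : nat) (g : k.-tuple (BS n)) : nat :=
  (\sum_(i < k) geodesic_length (tnth g i))%N.

(* Main.v *)
Require Import Defs.
From mathcomp Require Import all_boot order ssralg ssrnum ssrint rat intdiv.
From mathcomp Require Import boolp.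
From mathcomp Require Import zify ring.

Set Implicit Arguments.
Unset Strict Implicit.
Unset Printing Implicit Defensive.

Import Order.TTheory GRing.Theory Num.Theory.
Local Open Scope ring_scope.

(** Send an element of BS(1,n) to a pair (x, h) in the semidirect product of
    Z[1/n] by Z with (x, h)(y, l) = (x + n^-h y, h + l), where a is (1, 0) and
    t is (0, 1).  This map is injective ([BS_height_shift_faithful]), so that
    W = 1, with unknowns z_i = (x_i, m_i), splits into a linear equation on the
    heights m_i and, once the heights are fixed, one linear equation
    sum_i c_i(m) x_i + K(m) = 0 over Z[1/n].  As z_i occurs exactly twice, c_i
    is, up to sign and powers of n, equal to 1 - n^-g if the two exponents of
    z_i differ, and to 1 + n^-g if they agree ([coef_gap]); the gap g is an
    affine function of the heights.

    Put L = |W|.  For |n| > 1, an element (x, h) has length |h| plus the number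
    of digits of x in base n, up to a constant factor.  Since W has at most L/2
    variables, it suffices to find a solution in which every m_i is O(L^2) and
    every x_i has O(L^2) digits.

    If Q divides n^D - 1, the coefficients c_i(m) and K(m) modulo Q depend only
    on m modulo D.  Hence, if m' is congruent to m modulo D, solves the height
    equation, and if some coefficient c_i(m') is Q up to a power of n, then a
    solution at the heights m gives one at the heights m': reduce all x_j
    modulo Q, and absorb the error, a multiple of Q, into x_i
    ([solves_mod]).  The number of digits of the result is governed by D and by
    the heights of the prefixes of W at m'.  It remains to find m' and i with
    D = O(L) and with prefixes of height O(L^2).

    On the solutions of the height equation, the gap of z_i has the form
    beta + sum_(j != i) B_j m_j with B_j in {-1, 0, 1} and |beta| <= 2 L
    ([gap_affine]); this is the place where the pattern of the two occurrences
    of each z_j matters.  Take for i a variable whose exponents agree if there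
    is one.  If some B_j is nonzero, m_j can be chosen so that the gap is 0 when
    the exponents agree and 1 when they differ; then c_i is essentially 2 or
    n - 1, and D = 1 will do.  If all B_j vanish, the gap is the constant beta.
    If beta = 0 and the exponents agree, c_i is again essentially 2; if beta is
    nonzero, the heights can be reduced modulo D = |beta| or 2 |beta|, with
    Q = n^|beta| - 1 or n^|beta| + 1 ([bounded_or_trivial]).

    What is left is the case where all exponents differ and all gaps are 0, so
    that every c_i vanishes and K(m) = 0.  There x = 0 is a solution, but m has
    to be made small.  Every height is replaced by its residue modulo some D of
    order L^2, in a window of residues that avoids the L + 1 lowest ones
    ([modz_window], [reheight]).  The new K is a multiple of n^D - 1 up to a
    power of n, and too small to be nonzero ([bounded_of_trivial_gaps]).

    If |n| = 1, powers of n depend only on the parity of the exponent, and the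
    same reduction with D = Q = 2 settles everything ([bounded_absz1]). *)

(** * Heights and shifts of words *)

Definition letter_height (S : Type) (mu : S -> int) (l : S * bool) : int :=
  if l.2 then mu l.1 else - mu l.1.

Definition height (S : Type) (mu : S -> int) (w : word S) : int :=
  \sum_(l <- w) letter_height mu l.

Definition letter_shift (S : Type) (N : rat) (mu : S -> int) (y : S -> rat)
    (l : S * bool) : rat :=
  if l.2 then y l.1 else - (N ^ mu l.1 * y l.1).

(** With [height], the image of a word in the semidirect product, when each
    symbol s is sent to (y s, mu s) and a prefix of height h scales what
    follows it by N^-h. *)
Fixpoint shift (S : Type) (N : rat) (mu : S -> int) (y : S -> rat)
    (w : word S) : rat :=
  if w is l :: w'
  then letter_shift N mu y l + N ^ (- letter_height mu l) * shift N mu y w'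
  else 0.

Lemma height_nil (S : Type) (mu : S -> int) : height mu [::] = 0.
Proof. by rewrite /height big_nil. Qed.

Lemma height_cons (S : Type) (mu : S -> int) l w :
  height mu (l :: w) = letter_height mu l + height mu w.
Proof. by rewrite /height big_cons. Qed.

Lemma height_cat (S : Type) (mu : S -> int) u v :
  height mu (u ++ v) = height mu u + height mu v.
Proof. by rewrite /height big_cat. Qed.

(** Heights and shifts are linear in the data attached to the symbols.  This
    and [shift_affine] separate the contribution of each variable of an
    equation from that of the constants. *)
Lemma height_affine (S : Type) (k : nat) (nu : 'I_k -> S -> int)
    (mu0 : S -> int) (m : 'I_k -> int) (w : word S) :
  height (fun s => mu0 s + \sum_i m i * nu i s) w =
  height mu0 w + \sum_i m i * height (nu i) w.
Proof.
elim: w => [|[s b] w IH].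
  by rewrite !height_nil big1 ?addr0 // => i _; rewrite height_nil mulr0.
rewrite !height_cons IH.
under [in RHS]eq_bigr => i _ do rewrite height_cons mulrDr.
rewrite big_split /=.
suff -> : letter_height (fun s => mu0 s + \sum_i m i * nu i s) (s, b) =
  letter_height mu0 (s, b) + \sum_i m i * letter_height (nu i) (s, b) by ring.
case: b; rewrite /letter_height //= opprD -sumrN; congr (_ + _).
by apply: eq_bigr => i _; rewrite mulrN.
Qed.

Lemma ext_height (S : Type) (mu mu' : S -> int) :
  mu =1 mu' -> height mu =1 height mu'.
Proof. by move=> E w; apply: eq_bigr => l _; rewrite /letter_height !E. Qed.

Lemma ext_shift (S : Type) (N : rat) (mu mu' : S -> int) (y y' : S -> rat) :
  mu =1 mu' -> y =1 y' -> shift N mu y =1 shift N mu' y'.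
Proof.
move=> E E'; elim=> [|l w IH] //=.
by rewrite IH /letter_shift /letter_height !E !E'.
Qed.

Lemma shift_cat (S : Type) (N : rat) (mu : S -> int) (y : S -> rat) u v :
  N != 0 ->
  shift N mu y (u ++ v) = shift N mu y u + N ^ (- height mu u) * shift N mu y v.
Proof.
move=> N0; elim: u => [|l u IH] /=; first by rewrite height_nil expr0z; ring.
by rewrite IH height_cons opprD expfzDr //; ring.
Qed.

Lemma shift_affine (S : Type) (N : rat) (k : nat) (mu : S -> int)
    (y : 'I_k -> S -> rat) (y0 : S -> rat) (x : 'I_k -> rat) (w : word S) :
  shift N mu (fun s => y0 s + \sum_i x i * y i s) w =
  shift N mu y0 w + \sum_i x i * shift N mu (y i) w.
Proof.
elim: w => [|[s b] w IH] /=; first by rewrite big1 ?addr0 // => i _; rewrite mulr0.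
rewrite IH; under [in RHS]eq_bigr => i _ do rewrite mulrDr mulrCA.
rewrite big_split /= -mulr_sumr.
suff -> : letter_shift N mu (fun s => y0 s + \sum_i x i * y i s) (s, b) =
  letter_shift N mu y0 (s, b) + \sum_i x i * letter_shift N mu (y i) (s, b) by ring.
case: b; rewrite /letter_shift //= mulrDr opprD mulr_sumr -sumrN; congr (_ + _).
by apply: eq_bigr => i _; ring.
Qed.

Lemma height_take_cons (S : Type) (mu : S -> int) l w j :
  height mu (take j.+1 (l :: w)) = letter_height mu l + height mu (take j w).
Proof. by rewrite /= height_cons. Qed.

Lemma intr_neq0 (n : int) : n <> 0 -> n%:~R != 0 :> rat.
Proof. by move=> n0; rewrite intr_eq0; apply/eqP. Qed.

Lemma exprz_of_absz (N : rat) (z : int) : 0 <= z -> N ^ z = N ^+ `|z|%N.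
Proof. by case: z. Qed.

Lemma absz_add_le (x y : int) : (`|(x + y)%R| <= `|x| + `|y|)%N.
Proof. by lia. Qed.

(** A letter read at height h contributes an integer times n^-h, so a common
    denominator is governed by the highest prefix, and the size of the
    numerator by the spread between the highest and the lowest one.  Inverse
    letters are counted at the height where they end. *)
Lemma shift_bound (S : Type) (n : int) (mu : S -> int) (y : S -> rat)
    (Y : S -> int) (B : nat) (w : word S) (h0 h1 : int) :
  n <> 0 -> (forall s, y s = (Y s)%:~R) -> (forall s, (`|Y s| <= B)%N) ->
  (forall j, h0 <= height mu (take j w) <= h1) ->
  exists2 z : int, shift n%:~R mu y w = z%:~R * n%:~R ^ (- h1)
    & (`|z| <= size w * B * `|n| ^ `|(h1 - h0)%R|)%N.
Proof.
move=> nz yE YB; have N0 := intr_neq0 nz.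
have n0 : (0 < `|n|)%N by rewrite absz_gt0; apply/eqP.
elim: w h0 h1 => [|l w IH] h0 h1 hh /=.
  by exists 0; rewrite ?mul0r ?absz0.
have [z zE zB] : exists2 z : int,
    shift n%:~R mu y w = z%:~R * n%:~R ^ (- (h1 - letter_height mu l))
    & (`|z| <= size w * B * `|n| ^ `|(h1 - h0)%R|)%N.
  have -> : h1 - h0 = (h1 - letter_height mu l) - (h0 - letter_height mu l) by ring.
  by apply: IH => j; have := hh j.+1; rewrite height_take_cons; lia.
have := hh 0%N; rewrite take0 height_nil => /andP [h0le h1ge].
have := hh 1%N; rewrite height_take_cons take0 height_nil addr0 => hl.
have [f fE fB] : exists2 f : nat, letter_shift n%:~R mu y l =
    ((if l.2 then Y l.1 else - Y l.1) * n ^+ f)%:~R * n%:~R ^ (- h1)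
    & (f <= `|(h1 - h0)|)%N.
  rewrite /letter_shift; case: l hl {zE hh} => s [] /= hl.
    exists `|h1|%N; last by lia.
    rewrite intrM rmorphXn /= -[n%:~R ^+ _]exprz_of_absz // -mulrA -expfzDr //.
    by rewrite subrr expr0z mulr1 yE.
  exists `|(h1 + mu s)%R|%N; last by move: hl; rewrite /letter_height /=; lia.
  rewrite intrM rmorphXn /= -[n%:~R ^+ _]exprz_of_absz; last first.
    by move: hl; rewrite /letter_height /=; lia.
  rewrite -mulrA -expfzDr // intrN -yE mulNr mulrC; congr (- (_ * _ ^ _)); ring.
exists ((if l.2 then Y l.1 else - Y l.1) * n ^+ f + z).
  rewrite fE zE [in RHS]intrD mulrDl mulrCA -expfzDr //.
  by congr (_ + _ * _ ^ _); ring.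
apply: leq_trans (absz_add_le _ _) _.
rewrite mulSn mulnDl leq_add //.
rewrite abszM leq_mul //; first by case: l.2; rewrite ?abszN; apply: YB.
by rewrite abszX leq_pexp2l.
Qed.

(** * Congruences in Z[1/n] *)

(** The ideal generated by Q in Z[1/n]; the ring Z[1/n] itself for Q = 1, and
    the zero ideal for Q = 0. *)
Definition in_ideal (n Q : int) (x : rat) : Prop :=
  exists z : int, exists e : nat, x = (Q * z)%:~R * n%:~R ^ (- e%:Z).

Lemma in_idealD (n Q : int) (x y : rat) :
  n <> 0 -> in_ideal n Q x -> in_ideal n Q y -> in_ideal n Q (x + y).
Proof.
move=> /intr_neq0 N0 [z [e ->]] [z' [e' ->]].
exists (z * n ^+ e' + z' * n ^+ e), (e + e')%N.
rewrite PoszD opprD expfzDr // !intrM intrD !intrM !rmorphXn /= -!exprnN.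
field; rewrite ?expf_neq0 //.
Qed.

Lemma in_idealN (n Q : int) (x : rat) : in_ideal n Q x -> in_ideal n Q (- x).
Proof. by move=> [z [e ->]]; exists (- z), e; rewrite mulrN intrN mulNr. Qed.

Lemma in_idealM (n Q : int) (x y : rat) :
  n <> 0 -> in_ideal n Q x -> in_ideal n 1 y -> in_ideal n Q (x * y).
Proof.
move=> /intr_neq0 N0 [z [e ->]] [z' [e' ->]].
exists (z * z'), (e + e')%N.
by rewrite PoszD opprD expfzDr // !intrM; ring.
Qed.

Lemma in_idealMl (n Q : int) (x y : rat) :
  n <> 0 -> in_ideal n 1 x -> in_ideal n Q y -> in_ideal n Q (x * y).
Proof. by move=> n0 hx hy; rewrite mulrC; apply: in_idealM. Qed.

Lemma in_ideal_dvd (n Q z : int) : (Q %| z)%Z -> in_ideal n Q z%:~R.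
Proof.
by move=> /dvdzP [q ->]; exists q, 0%N; rewrite oppr0 expr0z mulr1 mulrC.
Qed.

Lemma in_ideal_int (n z : int) : in_ideal n 1 z%:~R.
Proof. by apply: in_ideal_dvd; rewrite dvd1z. Qed.

Lemma in_ideal_exp (n e : int) : in_ideal n 1 (n%:~R ^ e).
Proof.
case: e => e; last by exists 1, e.+1; rewrite mulr1 mul1r NegzE.
by rewrite -exprnP -rmorphXn; apply: in_ideal_int.
Qed.

Lemma dvd_expM_sub1 (Q n : int) (D q : nat) :
  (Q %| n ^+ D - 1)%Z -> (Q %| n ^+ (D * q) - 1)%Z.
Proof. by move=> h; rewrite exprM subrX1 dvdz_mulr. Qed.

Lemma in_ideal_exp_sub (n Q : int) (D : nat) (a b : int) :
  n <> 0 -> (Q %| n ^+ D - 1)%Z -> (D %| a - b)%Z ->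
  in_ideal n Q (n%:~R ^ a - n%:~R ^ b).
Proof.
move=> n0 hQ; have N0 := intr_neq0 n0.
wlog: a b / b <= a.
  move=> H; case: (leP b a) => [|/ltW] hab hD; first exact: H.
  by rewrite -opprB; apply/in_idealN/H => //; rewrite -rpredN opprB.
move=> hab /dvdzP [q qE].
have [q' q'E] : exists q' : nat, a = b + (D * q')%:Z.
  case: D {hQ} qE => [|D] qE; first by exists 0%N; move: qE; lia.
  have q0 : 0 <= q by rewrite -(pmulr_lge0 _ (ltn0Sn D : 0 < D.+1%:Z)); lia.
  by exists `|q|%N; rewrite PoszM; lia.
rewrite q'E expfzDr // -[X in _ - X]mulr1 -mulrBr.
apply: in_idealMl => //; first exact: in_ideal_exp.
have -> : n%:~R ^ (D * q')%:Z - 1 = (n ^+ (D * q') - 1)%:~R :> rat.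
  by rewrite intrB rmorphXn.
by apply/in_ideal_dvd/dvd_expM_sub1.
Qed.

(** When n^D = 1 modulo Q, a power of n modulo Q depends only on the residue of
    its exponent modulo D, negative exponents included; so heights may be
    changed modulo D without affecting shifts modulo Q. *)
Lemma shift_congr (S : Type) (n Q : int) (D : nat) (mu mu' : S -> int)
    (y y' : S -> rat) (w : word S) :
  n <> 0 -> (Q %| n ^+ D - 1)%Z -> (forall s, D %| mu s - mu' s)%Z ->
  (forall s, in_ideal n 1 (y' s)) ->
  (forall s, in_ideal n Q (y s - y' s)) ->
  in_ideal n Q (shift n%:~R mu y w - shift n%:~R mu' y' w) /\
  in_ideal n 1 (shift n%:~R mu' y' w).
Proof.
move=> n0 hQ hmu hy' hyy.
elim: w => [|l w [IH IH1]] /=.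
  by split; [rewrite subr0; apply: in_ideal_dvd (dvdz0 _)| apply: in_ideal_int 0].
have key (a a' x x' : rat) : in_ideal n Q (a - a') -> in_ideal n Q (x - x') ->
    in_ideal n 1 a -> in_ideal n 1 x' -> in_ideal n Q (a * x - a' * x').
  move=> h1 h2 h3 h4.
  have -> : a * x - a' * x' = a * (x - x') + (a - a') * x' by ring.
  by apply: in_idealD => //; [apply: in_idealMl | apply: in_idealM].
have hlh : (D %| letter_height mu l - letter_height mu' l)%Z.
  by rewrite /letter_height; case: l.2; rewrite // -opprD rpredN.
have hexp (a b : int) : (D %| a - b)%Z -> in_ideal n Q (n%:~R ^ a - n%:~R ^ b).
  exact: in_ideal_exp_sub.
split.
  have -> (a b c d : rat) : a + b - (c + d) = (a - c) + (b - d) by ring.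
  apply: in_idealD => //.
    rewrite /letter_shift; case: l.2 => //.
    rewrite -opprD; apply: in_idealN; apply: key => //; last exact: in_ideal_exp.
    exact: hexp.
  apply: key => //; last exact: in_ideal_exp.
  by apply: hexp; rewrite -opprD rpredN.
apply: in_idealD => //; last by apply: in_idealM => //; apply: in_ideal_exp.
rewrite /letter_shift; case: l.2 => //.
by apply: in_idealN; apply: in_idealM => //; apply: in_ideal_exp.
Qed.

(** Every class of Z[1/n] modulo Q contains a small integer, since the inverse
    of n modulo Q is n^(D-1). *)
Lemma ideal_residue (n Q : int) (D : nat) (x : rat) :
  n <> 0 -> Q <> 0 -> (0 < D)%N -> (Q %| n ^+ D - 1)%Z -> in_ideal n 1 x ->
  exists2 M : int, in_ideal n Q (x - M%:~R) & (`|M| <= `|Q|)%N.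
Proof.
move=> n0 Q0 D0 hQ [z [e ->]]; rewrite mul1r.
(* n^-e is congruent to n^(e (D-1)), as the exponents differ by e D. *)
exists (z * n ^+ (e * D.-1) %% Q)%Z; last first.
  have := ltz_mod (z * n ^+ (e * D.-1)) (introN eqP Q0).
  by have := modz_ge0 (z * n ^+ (e * D.-1)) (introN eqP Q0); lia.
have -> (a b c : rat) : a * b - c = a * (b - (n ^+ (e * D.-1))%:~R) +
   ((a * (n ^+ (e * D.-1))%:~R) - c) by ring.
apply: in_idealD => //.
  apply: in_idealMl => //; first exact: in_ideal_int.
  rewrite rmorphXn /= exprnP; apply: in_ideal_exp_sub hQ _ => //.
  apply/dvdzP; exists (- e%:Z); case: D D0 => // D _ /=.
  by rewrite PoszM -[D.+1]addn1 PoszD; ring.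
rewrite -intrM -intrB; apply: in_ideal_dvd.
by rewrite {1}(divz_eq (z * _) Q) addrK dvdz_mull.
Qed.

(** As n is a unit modulo Q, being a multiple of Q in Z[1/n] and in Z is the
    same for integers. *)
Lemma ideal_int_dvd (n Q z : int) (D : nat) :
  n <> 0 -> (0 < D)%N -> (Q %| n ^+ D - 1)%Z -> in_ideal n Q z%:~R -> (Q %| z)%Z.
Proof.
move=> n0 D0 hQ [z' [e E]]; have N0 := intr_neq0 n0.
have zE : z * n ^+ e = Q * z'.
  apply: (@intr_inj rat); rewrite intrM E rmorphXn /= exprnP -mulrA -expfzDr //.
  by rewrite addNr expr0z mulr1.
(* Here n^(D e) = n^e n^((D-1) e), and n^(D e) = 1 modulo Q. *)
have -> : z = - (z * (n ^+ (D * e) - 1)) + z * n ^+ e * n ^+ (D.-1 * e).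
  rewrite -mulrA -exprD; have -> : (e + D.-1 * e = D * e)%N by case: D D0 {hQ}.
  by ring.
rewrite rpredD //; first by rewrite rpredN dvdz_mull // dvd_expM_sub1.
by rewrite zE -mulrA dvdz_mulr.
Qed.

(** * BS(1,n) as a semidirect product *)

Definition gen_height (x : bs_gen) : int := if x is gen_t then 1 else 0.
Definition gen_shift (x : bs_gen) : rat := if x is gen_a then 1 else 0.

Lemma shift_nseq_a (n : int) (p : nat) (b : bool) :
  n <> 0 ->
  shift n%:~R gen_height gen_shift (nseq p (gen_a, b)) = (if b then 1 else -1) * p%:R.
Proof.
move=> n0; elim: p => [|p IH] /=; first by rewrite mulr0.
rewrite {}IH /letter_height /letter_shift /= oppr0 if_same expr0z -natr1.
by case: b => /=; ring.
Qed.

Lemma height_nseq_a (p : nat) (b : bool) :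
  height gen_height (nseq p (gen_a, b)) = 0.
Proof.
elim: p => [|p IH] /=; rewrite ?height_nil // height_cons IH /letter_height /=.
by case: b {IH}.
Qed.

Lemma bs_eqv_invariant (n : int) (u v : bs_word) :
  n <> 0 -> bs_eqv n u v ->
  height gen_height u = height gen_height v /\
  shift n%:~R gen_height gen_shift u = shift n%:~R gen_height gen_shift v.
Proof.
move=> n0; have N0 := intr_neq0 n0.
elim=> {u v} [u|u v _ [-> ->]|u v w _ [-> ->] _ [-> ->]
  |u u' v v' _ [h s] _ [h' s']|[x b]|].
- by [].
- by [].
- by [].
- by rewrite !height_cat !shift_cat // h s h' s'.
- rewrite !height_cons height_nil /=; split; first by case: b; case: x.
  case: b; case: x;
    by rewrite /letter_height /letter_shift /= ?expr0z ?expr1z ?mulr0 //; ring.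
rewrite height_nseq_a shift_nseq_a // !height_cons height_nil; split=> //.
rewrite /= /letter_height /letter_shift /= oppr0 opprK expr0z !expr1z.
by case: n n0 N0 => p; rewrite ?NegzE /= -?pmulrn ?intrN => _ _; ring.
Qed.

Definition BS_height (n : int) (g : BS n) : int := height gen_height (repr g).
Definition BS_shift (n : int) (g : BS n) : rat :=
  shift n%:~R gen_height gen_shift (repr g).

Lemma BS_height_pi (n : int) (u : bs_word) :
  n <> 0 -> BS_height (\pi_(BS n)%qT u) = height gen_height u.
Proof.
move=> n0; have /BS_eqP := reprK (\pi_(BS n)%qT u).
by case/(bs_eqv_invariant n0).
Qed.

Lemma BS_shift_pi (n : int) (u : bs_word) :
  n <> 0 -> BS_shift (\pi_(BS n)%qT u) = shift n%:~R gen_height gen_shift u.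
Proof.
move=> n0; have /BS_eqP := reprK (\pi_(BS n)%qT u).
by case/(bs_eqv_invariant n0).
Qed.

Lemma BS_heightM (n : int) (g h : BS n) : n <> 0 -> BS_height (g * h)%g = BS_height g + BS_height h.
Proof. by move=> n0; rewrite BS_height_pi // height_cat. Qed.

Lemma BS_shiftM (n : int) (g h : BS n) :
  n <> 0 -> BS_shift (g * h)%g = BS_shift g + n%:~R ^ (- BS_height g) * BS_shift h.
Proof. by move=> n0; rewrite BS_shift_pi // shift_cat //; apply: intr_neq0. Qed.

Lemma BS_height1 (n : int) : n <> 0 -> BS_height (1%g : BS n) = 0.
Proof. by move=> n0; rewrite BS_height_pi // height_nil. Qed.

Lemma BS_shift1 (n : int) : n <> 0 -> BS_shift (1%g : BS n) = 0.
Proof. by move=> n0; rewrite BS_shift_pi. Qed.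

Lemma BS_heightV (n : int) (g : BS n) : n <> 0 -> BS_height (g^-1)%g = - BS_height g.
Proof.
move=> n0; apply/eqP; rewrite -addr_eq0 addrC -BS_heightM // mulgV.
by rewrite BS_height1.
Qed.

Lemma BS_shiftV (n : int) (g : BS n) :
  n <> 0 -> BS_shift (g^-1)%g = - (n%:~R ^ BS_height g * BS_shift g).
Proof.
move=> n0; have := BS_shiftM (g^-1)%g g n0; rewrite mulVg BS_shift1 // BS_heightV // opprK.
by move/esym/eqP; rewrite addr_eq0 => /eqP.
Qed.

Lemma BS_height_eval (n : int) (X : Type) (f : X -> BS n) (w : word X) :
  n <> 0 -> BS_height (eval_word f w) = height (fun s => BS_height (f s)) w.
Proof.
move=> n0; elim: w => [|l w IH]; rewrite /eval_word.
  by rewrite big_nil height_nil BS_height1.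
rewrite big_cons -/(eval_word f w) BS_heightM // IH height_cons.
by rewrite /letter_height; case: l.2; rewrite ?BS_heightV.
Qed.

Lemma BS_shift_eval (n : int) (X : Type) (f : X -> BS n) (w : word X) :
  n <> 0 -> BS_shift (eval_word f w) =
    shift n%:~R (fun s => BS_height (f s)) (fun s => BS_shift (f s)) w.
Proof.
move=> n0; elim: w => [|l w IH]; rewrite /eval_word.
  by rewrite big_nil BS_shift1.
rewrite big_cons -/(eval_word f w) BS_shiftM // IH /= /letter_height /letter_shift.
by case: l.2; rewrite ?BS_heightV // BS_shiftV.
Qed.

Lemma BS_shift_in_ideal (n : int) (g : BS n) : n <> 0 -> in_ideal n 1 (BS_shift g).
Proof.
move=> n0; have := @shift_congr _ n 1 0 gen_height gen_height gen_shift gen_shift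
  (repr g) n0 (dvd1z _) _ _ _; case=> //.
- by move=> s; rewrite subrr dvdz0.
- by case; [exact: (in_ideal_int n 1) | exact: (in_ideal_int n 0)].
- by move=> s; rewrite subrr; apply: (in_ideal_int n 0).
Qed.

Definition apow (n : int) (z : int) : BS n :=
  match z with
  | Posz p => BS_gen n gen_a ^+ p
  | Negz p => (BS_gen n gen_a)^-1 ^+ p.+1
  end%g.

Lemma apowS (n z : int) : apow n (z + 1) = (apow n z * BS_gen n gen_a)%g.
Proof.
case: z => [p|[|p]]; first by rewrite -PoszD addn1 /= expgSr.
  by rewrite /= mulVg.
have -> : Negz p.+1 + 1 = Negz p by lia.
by rewrite /= [in RHS]expgSr mulgVK.
Qed.

Lemma apowP (n z : int) : apow n (z - 1) = (apow n z * (BS_gen n gen_a)^-1)%g.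
Proof. by rewrite -{2}[z](subrK 1) apowS mulgK. Qed.

Lemma apowD (n z z' : int) : apow n (z + z') = (apow n z * apow n z')%g.
Proof.
elim: z' => [|p IH|p IH]; first by rewrite addr0 mulg1.
  by rewrite -[p.+1]addn1 PoszD addrA !apowS IH mulgA.
by rewrite -[p.+1]addn1 PoszD opprD addrA !apowP IH mulgA.
Qed.

Lemma eval_word_nseq (G : groupType) (X : Type) (f : X -> G) (p : nat) l :
  (eval_word f (nseq p l) = (if l.2 then f l.1 else (f l.1)^-1) ^+ p)%g.
Proof.
elim: p => [|p IH]; rewrite /eval_word /= ?big_nil //.
by rewrite big_cons -/(eval_word f _) IH expgS.
Qed.

Lemma conj_apow (n z : int) :
  (apow n z * BS_gen n gen_t = BS_gen n gen_t * apow n (z * n))%g.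
Proof.
have rel : (BS_gen n gen_a * BS_gen n gen_t = BS_gen n gen_t * apow n n)%g.
  apply: (mulgI (BS_gen n gen_t)^-1%g); rewrite mulKg.
  have -> : apow n n = \pi_(BS n)%qT (nseq `|n|%N (gen_a, (0 <= n)%R)).
    by rewrite -eval_word_BS eval_word_nseq; case: n.
  have -> : ((BS_gen n gen_t)^-1)%g = \pi_(BS n)%qT [:: (gen_t, false)].
    by rewrite -eval_word_BS /eval_word big_seq1.
  rewrite [X in (_ * X)%g = _]BS_mul_pi [LHS]BS_mul_pi.
  by apply/BS_eqP; apply: bs_eqv_rel.
elim: z => [|p IH|p IH]; first by rewrite mul0r mul1g mulg1.
  by rewrite -[p.+1]addn1 PoszD apowS mulrDl mul1r apowD -mulgA rel !mulgA IH.
rewrite -[p.+1]addn1 PoszD opprD; set z := - p%:Z in IH *.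
apply: (mulIg (apow n n)); rewrite -!mulgA -apowD -rel.
rewrite mulrBl mul1r subrK !mulgA -apowS subrK //.
Qed.

Lemma apow_texp (n z : int) (i : nat) :
  (apow n z * BS_gen n gen_t ^+ i = BS_gen n gen_t ^+ i * apow n (z * n ^+ i)%R)%g.
Proof.
elim: i z => [|i IH] z; first by rewrite expr0 mulr1 mulg1 mul1g.
by rewrite expgS mulgA conj_apow -mulgA IH mulgA exprS mulrA.
Qed.

(** The relation lets t^-1 move to the right and t to the left across powers of
    a, but in general not in the opposite directions. *)
Lemma normal_form (n : int) (g : BS n) :
  exists i : nat, exists j : nat, exists z : int,
    (g = BS_gen n gen_t ^+ i * apow n z * (BS_gen n gen_t)^-1 ^+ j)%g.
Proof.
rewrite -[g]reprK -eval_word_BS.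
elim: (repr g) => [|[x b] u [i [j [z IH]]]].
  by exists 0%N, 0%N, 0; rewrite /eval_word big_nil !mulg1.
rewrite /eval_word big_cons -/(eval_word _ _) IH !mulgA /=.
case: x => /=.
  have -> : (if b then BS_gen n gen_a else (BS_gen n gen_a)^-1)%g
      = apow n (if b then 1 else -1) by case: b.
  by exists i, j, ((if b then 1 else -1) * n ^+ i + z); rewrite apow_texp apowD !mulgA.
case: b; first by exists i.+1, j, z; rewrite expgS.
case: i IH => [|i] _; last by exists i, j, z; rewrite expgS mulKg.
exists 0%N, j.+1, (z * n); rewrite mulg1 mul1g expgS !mulgA; congr (_ * _)%g.
by apply: (mulgI (BS_gen n gen_t)); rewrite !mulgA mulgV mul1g -conj_apow mulgK.
Qed.

Lemma BS_height_gen (n : int) (x : bs_gen) : n <> 0 -> BS_height (BS_gen n x) = gen_height x.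
Proof. by move=> n0; rewrite BS_height_pi // height_cons height_nil addr0. Qed.

Lemma BS_shift_gen (n : int) (x : bs_gen) : n <> 0 -> BS_shift (BS_gen n x) = gen_shift x.
Proof. by move=> n0; rewrite BS_shift_pi //= mulr0 addr0. Qed.

Lemma BS_height_apow (n z : int) : n <> 0 -> BS_height (apow n z) = 0.
Proof.
move=> n0; elim: z => [|p IH|p IH]; first by rewrite BS_height1.
  by rewrite -[p.+1]addn1 PoszD apowS BS_heightM // IH BS_height_gen.
by rewrite -[p.+1]addn1 PoszD opprD apowP BS_heightM // IH BS_heightV // BS_height_gen.
Qed.

Lemma BS_shift_apow (n z : int) : n <> 0 -> BS_shift (apow n z) = z%:~R.
Proof.
move=> n0; elim: z => [|p IH|p IH]; first by rewrite BS_shift1.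
  rewrite -[p.+1]addn1 PoszD apowS BS_shiftM // IH BS_height_apow // BS_shift_gen //.
  by rewrite oppr0 expr0z mul1r intrD.
rewrite -[p.+1]addn1 PoszD opprD apowP BS_shiftM // IH BS_height_apow // BS_shiftV // BS_height_gen // BS_shift_gen //.
by rewrite oppr0 expr0z !mul1r [in RHS]intrD.
Qed.

Lemma BS_height_texp (n : int) (i : nat) : n <> 0 -> BS_height (BS_gen n gen_t ^+ i)%g = i.
Proof.
move=> n0; elim: i => [|i IH]; first by rewrite BS_height1.
by rewrite expgS BS_heightM // IH BS_height_gen.
Qed.

Lemma BS_shift_texp (n : int) (i : nat) : n <> 0 -> BS_shift (BS_gen n gen_t ^+ i)%g = 0.
Proof.
move=> n0; elim: i => [|i IH]; first by rewrite BS_shift1.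
by rewrite expgS BS_shiftM // IH BS_shift_gen //= mulr0.
Qed.

(** On t^i a^z t^-j, height 0 gives i = j, and shift n^-i z = 0 gives z = 0. *)
Lemma BS_height_shift_faithful (n : int) (g : BS n) :
  n <> 0 -> BS_height g = 0 -> BS_shift g = 0 -> g = 1%g.
Proof.
move=> n0; have [i [j [z ->]]] := normal_form g.
have -> : ((BS_gen n gen_t)^-1 ^+ j = (BS_gen n gen_t ^+ j)^-1)%g by rewrite expVgn.
rewrite BS_heightM // BS_heightM // BS_heightV // !BS_height_texp // BS_height_apow // addr0 => /eqP.
rewrite subr_eq0 => /eqP [<-].
rewrite BS_shiftM // BS_shiftM // BS_shiftV // !BS_shift_texp // BS_shift_apow // mulr0 oppr0 mulr0 addr0 add0r.
move/eqP; rewrite mulf_eq0 (negbTE (expfz_neq0 _ (intr_neq0 n0))) /= intr_eq0.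
by move=> /eqP ->; rewrite mulg1 mulgV.
Qed.

(** * Lengths of elements *)

(** An upper bound on the length of (x, 0) in terms of words.  Unlike the
    geodesic length, it is visibly subadditive in x, and conjugation by powers
    of t scales x by powers of n. *)
Definition reachable (n : int) (B : nat) (x : rat) : Prop :=
  exists u : bs_word, [/\ height gen_height u = 0,
    shift n%:~R gen_height gen_shift u = x & (size u <= B)%N].

Lemma reachable0 (n : int) : reachable n 0 0.
Proof. by exists [::]; rewrite height_nil. Qed.

Lemma reachableW (n : int) (B B' : nat) (x : rat) :
  (B <= B')%N -> reachable n B x -> reachable n B' x.
Proof. by move=> BB' [u [h s hB]]; exists u; split=> //; apply: leq_trans BB'. Qed.

Lemma reachableD (n : int) (B B' : nat) (x x' : rat) :
  n <> 0 -> reachable n B x -> reachable n B' x' -> reachable n (B + B') (x + x').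
Proof.
move=> /intr_neq0 N0 [u [h s hB]] [v [h' s' hB']].
exists (u ++ v); rewrite height_cat shift_cat // h h' s s' size_cat leq_add //.
by rewrite oppr0 expr0z mul1r.
Qed.

Lemma height_nseq_t (p : nat) (b : bool) :
  height gen_height (nseq p (gen_t, b)) = if b then p%:Z else - p%:Z.
Proof.
elim: p => [|p IH]; first by rewrite height_nil; case: b.
by rewrite height_cons IH /letter_height /=; case: b {IH}; lia.
Qed.

Lemma shift_nseq_t (N : rat) (p : nat) (b : bool) :
  shift N gen_height gen_shift (nseq p (gen_t, b)) = 0.
Proof.
by elim: p => [|p IH] //=; rewrite IH /letter_shift /=; case: b {IH}; ring.
Qed.

Lemma reachable_scale (n : int) (B : nat) (x : rat) (e : int) :
  n <> 0 -> reachable n B x -> reachable n (B + 2 * `|e|) (n%:~R ^ e * x).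
Proof.
move=> /intr_neq0 N0 [u [h s hB]].
exists (nseq `|e| (gen_t, e < 0) ++ u ++ nseq `|e| (gen_t, ~~ (e < 0))).
rewrite !height_cat !shift_cat // !shift_nseq_t !height_nseq_t h s !size_cat !size_nseq.
split; [| |by lia].
  by case: ifP => /=; lia.
rewrite mulr0 addr0 add0r; congr (_ ^ _ * _).
by case: ifP => /=; lia.
Qed.

Lemma reachable_int (n z : int) :
  n <> 0 -> reachable n `|z| z%:~R.
Proof.
move=> n0; exists (nseq `|z| (gen_a, 0 <= z)).
rewrite height_nseq_a shift_nseq_a // size_nseq; split=> //.
by case: z => p; rewrite ?NegzE /= ?mul1r //= intrN mulN1r.
Qed.

(** Horner evaluation in base n: each digit costs at most |n| letters and a
    conjugation by t.  The factor K makes the bound meaningful also for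
    |n| = 1, where the B digits bring nothing. *)
Lemma reachable_bounded (n z : int) (K B : nat) :
  n <> 0 -> (`|z| <= K * `|n| ^ B)%N ->
  reachable n (K + (`|n| + 2) * B) z%:~R.
Proof.
move=> n0; have n1 : (0 < `|n|)%N by rewrite absz_gt0; apply/eqP.
elim: B z => [|B IH] z hz.
  apply: reachableW (reachable_int z n0).
  by rewrite muln0 addn0; rewrite expn0 muln1 in hz.
have [s sE sz] : exists2 s : int, z = s * `|z|%N & `|s|%N = 1%N.
  by case: (leP 0 z) => h; [exists 1 | exists (-1)]; lia.
have [s' sE' sn] : exists2 s : int, n = s * `|n|%N & `|s|%N = 1%N.
  by case: (leP 0 n) => h; [exists 1 | exists (-1)]; lia.
pose q := s * s' * (`|z| %/ `|n|)%N; pose r := s * (`|z| %% `|n|)%N.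
have ss' : s' * s' = 1 by have [->|->] : s' = 1 \/ s' = -1 by lia.
have zE : z = r + n * q.
  have -> : n * q = s * ((`|z| %/ `|n|)%N%:Z * `|n|%N%:Z).
    by rewrite /q {1}sE' -[RHS]mul1r -ss'; ring.
  by rewrite /r -mulrDr -PoszM -PoszD addnC -divn_eq.
have -> : z%:~R = r%:~R + n%:~R ^ 1 * q%:~R :> rat by rewrite expr1z -intrM -intrD -zE.
have rB : reachable n `|n| r%:~R.
  apply: reachableW (reachable_int r n0).
  by rewrite /r abszM sz mul1n absz_nat ltnW // ltn_mod.
have qB : reachable n (K + (`|n| + 2) * B) q%:~R.
  apply: IH; rewrite /q !abszM sz sn !mul1n absz_nat.
  by apply: leq_trans (leq_div2r _ hz) _; rewrite expnSr mulnA mulnK.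
apply: reachableW (reachableD n0 rB (reachable_scale 1 n0 qB)).
by rewrite mulnS; lia.
Qed.

Lemma reachable_lift (n : int) (B : nat) (x : rat) (m : int) :
  n <> 0 -> reachable n B x ->
  exists g : BS n, [/\ BS_height g = m, BS_shift g = x & (geodesic_length g <= B + `|m|)%N].
Proof.
move=> n0 [u [h s hB]]; pose v := u ++ nseq `|m| (gen_t, 0 <= m).
exists (\pi_(BS n)%qT v); split.
- by rewrite BS_height_pi // height_cat h height_nseq_t; case: ifP; lia.
- by rewrite BS_shift_pi // shift_cat ?intr_neq0 // shift_nseq_t mulr0 addr0.
rewrite /geodesic_length; case: ex_minnP => p _ hmin.
apply: leq_trans (hmin (size v) _) _.
  by apply/asboolP; exists v => //; rewrite eval_word_BS.
by rewrite size_cat size_nseq leq_add2r.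
Qed.

(** * The linear equation attached to an equation over BS(1,n) *)

Definition sym_height (k : nat) (m : 'I_k -> int) (s : eq_symbol k) : int :=
  match s with inl i => m i | inr x => gen_height x end.

Definition sym_shift (k : nat) (x : 'I_k -> rat) (s : eq_symbol k) : rat :=
  match s with inl i => x i | inr c => gen_shift c end.

(** The unknowns are read in coordinates: z_i = (x i, m i).  The x i are
    arbitrary rationals here; membership in Z[1/n] is a separate hypothesis
    where it is needed. *)
Definition solves (n : int) (k : nat) (W : word (eq_symbol k))
    (m : 'I_k -> int) (x : 'I_k -> rat) : Prop :=
  height (sym_height m) W = 0 /\
  shift n%:~R (sym_height m) (sym_shift x) W = 0.

Lemma solves_of_solution (n : int) (k : nat) (W : word (eq_symbol k))
    (g : k.-tuple (BS n)) :
  n <> 0 -> is_solution W g ->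
  solves n W (fun i => BS_height (tnth g i)) (fun i => BS_shift (tnth g i)).
Proof.
move=> n0 sol.
have hE : (fun s => BS_height (eq_subst g s)) =1 sym_height (fun i => BS_height (tnth g i)).
  by case=> // c; rewrite /= BS_height_gen.
have sE : (fun s => BS_shift (eq_subst g s)) =1 sym_shift (fun i => BS_shift (tnth g i)).
  by case=> // c; rewrite /= BS_shift_gen.
split; first by rewrite -(ext_height hE) -BS_height_eval // sol BS_height1.
by rewrite -(ext_shift _ hE sE) -BS_shift_eval // sol BS_shift1.
Qed.

Lemma solution_of_solves (n : int) (k : nat) (W : word (eq_symbol k))
    (m : 'I_k -> int) (x : 'I_k -> rat) (B M : nat) :
  n <> 0 -> solves n W m x -> (forall i, reachable n B (x i)) ->
  (forall i, `|m i| <= M)%N ->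
  exists2 g : k.-tuple (BS n), is_solution W g & (solution_size g <= k * (B + M))%N.
Proof.
move=> n0 [hW sW] xB mM.
have [f fP] := fin_all_exists (fun i => reachable_lift (m i) n0 (xB i)).
pose g := [tuple f i | i < k].
have gE i : tnth g i = f i by rewrite tnth_mktuple.
have hE : (fun s => BS_height (eq_subst g s)) =1 sym_height m.
  by case=> [i|c] /=; rewrite ?gE ?BS_height_gen //; case: (fP i).
have sE : (fun s => BS_shift (eq_subst g s)) =1 sym_shift x.
  by case=> [i|c] /=; rewrite ?gE ?BS_shift_gen //; case: (fP i).
exists g.
  apply: BS_height_shift_faithful => //; first by rewrite BS_height_eval // (ext_height hE).
  by rewrite BS_shift_eval // (ext_shift _ hE sE).
rewrite /solution_size -[X in (_ <= X * _)%N]card_ord -sum_nat_const.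
apply: leq_sum => i _; rewrite gE; case: (fP i) => _ _ /leq_trans; apply.
by rewrite leq_add2l.
Qed.

Definition coef (n : int) (k : nat) (m : 'I_k -> int) (i : 'I_k)
    (W : word (eq_symbol k)) : rat :=
  shift n%:~R (sym_height m) (fun s => (s == inl i)%:R) W.

(** For fixed heights, the shift equation is affine in the x i. *)
Lemma shift_coef (n : int) (k : nat) (m : 'I_k -> int) (x : 'I_k -> rat)
    (W : word (eq_symbol k)) :
  shift n%:~R (sym_height m) (sym_shift x) W =
  shift n%:~R (sym_height m) (sym_shift (fun=> 0)) W + \sum_i x i * coef n m i W.
Proof.
rewrite -shift_affine; apply: ext_shift => // -[j|c] /=.
  rewrite add0r (bigD1 j) //= eqxx mulr1 big1 ?addr0 // => i /negbTE ij.
  by rewrite (inj_eq (@inl_inj _ _)) eq_sym ij mulr0.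
by rewrite big1 ?addr0 // => i _; rewrite mulr0.
Qed.

Lemma shift_vanish (S : eqType) (N : rat) (mu : S -> int) (s : S) (w : word S) :
  count (fun l => l.1 == s) w = 0%N ->
  shift N mu (fun s' => (s' == s)%:R) w = 0.
Proof.
elim: w => [|l w IH] //=; have [//|ls] := boolP (l.1 == s).
rewrite add0n => /IH ->; rewrite /letter_shift (negbTE ls).
by rewrite !mulr0 oppr0 if_same addr0.
Qed.

Definition occ (k : nat) (i : 'I_k) (w : word (eq_symbol k)) : nat :=
  count (fun l => l.1 == inl i :> eq_symbol k) w.

Arguments occ : simpl never.

Lemma occ_cat (k : nat) (i : 'I_k) (u v : word (eq_symbol k)) :
  occ i (u ++ v) = (occ i u + occ i v)%N.
Proof. exact: count_cat. Qed.

Lemma occ_cons (k : nat) (i : 'I_k) l (w : word (eq_symbol k)) :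
  occ i (l :: w) = ((l.1 == inl i) + occ i w)%N.
Proof. by []. Qed.

(** The difference of the heights at which the two occurrences of z_i start,
    when each edge z_i^-1 is traversed backwards: for equal exponents, the
    passage through z_i itself counts as well as U. *)
Definition gap (k : nat) (m : 'I_k -> int) (i : 'I_k) (e e' : bool)
    (U : word (eq_symbol k)) : int :=
  height (sym_height m) U + if e == e' then (if e then m i else - m i) else 0.

(** Only the two occurrences of z_i contribute, and each contributes a signed
    power of n; their quotient is n^-gap, up to the sign. *)
Lemma coef_gap (n : int) (k : nat) (m : 'I_k -> int) (i : 'I_k) (e e' : bool)
    (A U V : word (eq_symbol k)) :
  n <> 0 ->
  occ i A = 0%N ->
  occ i U = 0%N ->
  occ i V = 0%N ->
  coef n m i (A ++ (inl i, e) :: U ++ (inl i, e') :: V) =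
  n%:~R ^ (- height (sym_height m) A + if e then 0 else m i) *
  (if e then 1 else - 1) *
  (if e == e' then 1 + n%:~R ^ (- gap m i e e' U)
   else 1 - n%:~R ^ (- gap m i e e' U)).
Proof.
move=> /intr_neq0 N0 hA hU hV; rewrite /coef.
rewrite shift_cat // shift_vanish //= shift_cat // shift_vanish //= shift_vanish //.
rewrite /letter_shift /letter_height /= eqxx /gap.
case: e; case: e' => /=; rewrite ?oppr0 ?opprK ?addr0 ?opprD ?opprK ?(expfzDr _ _ N0);
  set N := n%:~R in N0 *; set a := height _ A; set h := height _ U;
  rewrite -?invr_expz; have := expfz_neq0 (m i) N0; have := expfz_neq0 h N0;
  have := expfz_neq0 a N0; set x := N ^ m i; set y := N ^ h; set z := N ^ a;
  move=> ? ? ?; field => //; do ?[apply/andP; split] => //.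
Qed.

Lemma prefix_height_le (S : Type) (mu : S -> int) (w : word S) (j : nat) :
  (`|height mu (take j w)| <= \sum_(l <- w) `|letter_height mu l|)%N.
Proof.
elim: w j => [|l w IH] [|j]; rewrite ?height_nil ?big_nil //= height_cons big_cons.
exact: leq_trans (absz_add_le _ _) (leq_add (leqnn _) (IH j)).
Qed.

(** * Changing the heights of a solution *)

(** The given solution still solves the shift equation modulo Q at the heights
    m'.  Replacing all x i by small residues modulo Q leaves an error that is Q
    times an element of Z[1/n] with controlled numerator and denominator, and
    the coefficient of x i0, being Q up to a power of n and the factor v, lets
    x i0 absorb it.  The factor v serves for signs, and for even n, where
    the coefficient 2 is a unit of Z[1/n] and v = n/2 turns it into n. *)
Lemma solves_mod (n : int) (k : nat) (W : word (eq_symbol k))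
    (m m' : 'I_k -> int) (x : 'I_k -> rat) (i0 : 'I_k) (D H : nat)
    (Q v e : int) :
  n <> 0 -> (0 < D)%N -> Q <> 0 -> (Q %| n ^+ D - 1)%Z ->
  solves n W m x -> (forall i, in_ideal n 1 (x i)) ->
  (forall i, D %| m i - m' i)%Z ->
  height (sym_height m') W = 0 ->
  coef n m' i0 W * v%:~R = n%:~R ^ e * Q%:~R ->
  (\sum_(l <- W) `|letter_height (sym_height m') l| <= H)%N ->
  (`|Q| <= 2 * `|n| ^ D)%N -> (`|v| <= `|n|)%N -> (`|e| <= H + D)%N ->
  exists2 x' : 'I_k -> rat, solves n W m' x' &
    forall i, reachable n
      (2 + (`|n| + 2) * D + (size W + (`|n| + 2) * (2 * H + 1)) + 2 * (2 * H + D))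
      (x' i).
Proof.
move=> n0 D0 Q0 hQ [hW sW] xI mD hW' cE HB QB vB eB.
have N0 := intr_neq0 n0; have n1 : (0 < `|n|)%N by rewrite absz_gt0; apply/eqP.
have Q1 : (0 < `|Q|)%N by rewrite absz_gt0; apply/eqP.
have [M MP] := fin_all_exists (fun i =>
  let: ex_intro2 M h1 h2 := ideal_residue n0 Q0 D0 hQ (xI i) in
  ex_intro (fun M : int => in_ideal n Q (x i - M%:~R) /\ (`|M| <= `|Q|)%N)
    M (conj h1 h2)).
pose Y := shift n%:~R (sym_height m') (sym_shift (fun i => (M i)%:~R)) W.
have YI : in_ideal n Q Y.
  have h1 s : (D %| sym_height m s - sym_height m' s)%Z.
    by case: s => [i|c] //=; rewrite subrr dvdz0.
  have h2 s : in_ideal n 1 (sym_shift (fun i => (M i)%:~R) s).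
    by case: s => [i|[]] /=;
      [exact: in_ideal_int | exact: (in_ideal_int n 1) | exact: (in_ideal_int n 0)].
  have h3 s : in_ideal n Q (sym_shift x s - sym_shift (fun i => (M i)%:~R) s).
    case: s => [i|c] /=; first by case: (MP i).
    by rewrite subrr; apply: in_ideal_dvd (dvdz0 _).
  have [+ _] := shift_congr W n0 hQ h1 h2 h3.
  by rewrite sW sub0r => /in_idealN; rewrite opprK.
have [z YE zB] : exists2 z : int, Y = z%:~R * n%:~R ^ (- H%:Z)
    & (`|z| <= size W * `|Q| * `|n| ^ `|(H%:Z - - H%:Z)%R|)%N.
  apply: (@shift_bound _ n _ _ (fun s => match s with inl i => M i
    | inr c => if c is gen_a then 1 else 0 end)) => //.
  - by case=> [i|[]].
  - by case=> [i|[]] //=; case: (MP i).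
  - move=> j; have := leq_trans (prefix_height_le (sym_height m') W j) HB.
    by set q := height _ _; lia.
have /dvdzP [R zE] : (Q %| z)%Z.
  apply: (ideal_int_dvd n0 D0 hQ).
  have -> : z%:~R = Y * n%:~R ^ H%:Z :> rat.
    by rewrite YE -mulrA -expfzDr // addNr expr0z mulr1.
  exact: in_idealM n0 YI (in_ideal_exp n H).
have RB : (`|R| <= size W * `|n| ^ (2 * H))%N.
  rewrite -(leq_pmul2r Q1) -abszM -zE (leq_trans zB) // mulnAC leq_mul // leq_mul //.
  by have -> : (`|(H%:Z - - H%:Z)%R| = 2 * H)%N by lia.
(* The shift error is Q R n^-H; d is its quotient by the coefficient. *)
pose d : rat := n%:~R ^ (- H%:Z - e) * (- (R * v))%:~R.
have dE : d * coef n m' i0 W = - Y.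
  have -> : d * coef n m' i0 W =
     - (n%:~R ^ (- H%:Z - e) * R%:~R * (coef n m' i0 W * v%:~R)).
    by rewrite /d intrN intrM; ring.
  rewrite cE YE zE intrM; congr (- _).
  have -> : n%:~R ^ (- H%:Z) = n%:~R ^ (- H%:Z - e) * n%:~R ^ e :> rat.
    by rewrite -expfzDr // subrK.
  ring.
exists (fun i => (M i)%:~R + (if i == i0 then d else 0)).
  split=> //; rewrite shift_coef.
  under eq_bigr => i _ do rewrite mulrDl.
  rewrite big_split /= addrA -shift_coef -/Y (bigD1 i0) //= eqxx dE big1 ?addr0 ?subrr //.
  by move=> i /negbTE ->; rewrite mul0r.
move=> i; rewrite -addnA; apply: reachableD => //.
  apply: reachable_bounded => //; case: (MP i) => _ h; exact: leq_trans h QB.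
case: ifP => _; last by apply: reachableW (reachable0 n).
apply: reachableW (reachable_scale (- H%:Z - e) n0
  (@reachable_bounded n (- (R * v)) (size W) (2 * H + 1) n0 _)).
  by rewrite leq_add2l leq_mul2l; lia.
by rewrite abszN abszM expnD expn1 mulnA leq_mul.
Qed.

(** * Quadratic words: how gaps depend on heights *)

Lemma count_split (T : Type) (p : pred T) (w : seq T) c :
  count p w = c.+1 ->
  exists A l V, [/\ w = A ++ l :: V, p l, count p A = 0%N & count p V = c].
Proof.
elim: w => [|l w IH] //=; case: (boolP (p l)) => pl; rewrite ?add1n ?add0n.
  by case=> cE; exists [::], l, w.
by case/IH=> A [l' [V [-> pl' A0 V0]]]; exists (l :: A), l', V; rewrite /= (negbTE pl).
Qed.

Variant two_occurrences (k : nat) (i : 'I_k) (W : word (eq_symbol k)) : Prop :=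
  TwoOccurrences A e U e' V of
    W = A ++ (inl i, e) :: U ++ (inl i, e') :: V
    & occ i A = 0%N
    & occ i U = 0%N
    & occ i V = 0%N.

Lemma quadraticP (k : nat) (i : 'I_k) (W : word (eq_symbol k)) :
  quadratic W -> two_occurrences i W.
Proof.
rewrite /occ; move=> /(_ i) /count_split [A [[s e] [V [WE /eqP/= sE A0 /count_split]]]].
case=> U [[s' e'] [V' [VE /eqP/= sE' U0 V0]]].
by exists A e U e' V'; rewrite // WE VE sE sE'.
Qed.

Lemma quadratic_vars (k : nat) (W : word (eq_symbol k)) :
  quadratic W -> (k * 2 <= size W)%N.
Proof.
move=> qW.
have <- : (\sum_(i < k) occ i W = k * 2)%N.
  by rewrite /occ (eq_bigr (fun=> 2%N)) ?sum_nat_const ?card_ord // => i _; rewrite qW.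
rewrite /occ; elim: W {qW} => [|[s b] w IH] /=; first by rewrite big1.
rewrite big_split /= -add1n leq_add //; case: s => [j|c]; last by rewrite big1.
rewrite (bigD1 j) //= eqxx big1 // => i /negbTE ij.
by rewrite (inj_eq (@inl_inj _ _)) eq_sym ij.
Qed.

Definition scount (k : nat) (j : 'I_k) (w : word (eq_symbol k)) : int :=
  height (fun s => (s == inl j)%:R) w.

Lemma height_scount (k : nat) (m : 'I_k -> int) (w : word (eq_symbol k)) :
  height (sym_height m) w =
  height (sym_height (fun=> 0)) w + \sum_j m j * scount j w.
Proof.
rewrite -height_affine; apply: ext_height => -[j|c] /=.
  rewrite add0r (bigD1 j) //= eqxx mulr1 big1 ?addr0 // => i /negbTE ij.
  by rewrite (inj_eq (@inl_inj _ _)) eq_sym ij mulr0.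
by rewrite big1 ?addr0 // => i _; rewrite mulr0.
Qed.

Lemma scount_count (k : nat) (j : 'I_k) (w : word (eq_symbol k)) :
  scount j w = (count (pred1 (inl j, true)) w)%:Z - (count (pred1 (inl j, false)) w)%:Z
  /\ occ j w =
     (count (pred1 (inl j, true)) w + count (pred1 (inl j, false)) w)%N.
Proof.
elim: w => [|[s b] w [IH IH']] /=; first by rewrite /scount height_nil.
rewrite /scount height_cons -/(scount j w) IH occ_cons IH' /letter_height /= !xpair_eqE.
by case: (s == inl j); case: b => /=; split; lia.
Qed.

Lemma scount0 (k : nat) (j : 'I_k) (w : word (eq_symbol k)) :
  occ j w = 0%N -> scount j w = 0.
Proof. by case: (scount_count j w) => -> ->; lia. Qed.

(** Half of the signed number of occurrences of z_j in a quadratic word: 0 if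
    its two exponents differ, and otherwise their common value. *)
Definition half_scount (k : nat) (W : word (eq_symbol k)) (j : 'I_k) : int :=
  (count (pred1 (inl j, true)) W)%:Z - 1.

Lemma scount_sign (k : nat) (j : 'I_k) (W : word (eq_symbol k)) :
  quadratic W -> scount j W = 2 * half_scount W j /\ (`|half_scount W j| <= 1)%N.
Proof.
move=> /(_ j); rewrite -/(occ j W); case: (scount_count j W) => -> ->.
by rewrite /half_scount; split; lia.
Qed.

(** If the exponents of z_j differ, U contains each of z_j and z_j^-1 at most
    once; if both are s, it contains z_j^s at most twice, and |2 s - s| = 1. *)
Lemma scount_infix (k : nat) (j : 'I_k) (A U V : word (eq_symbol k)) :
  quadratic (A ++ U ++ V) ->
  (`|(scount j U - half_scount (A ++ U ++ V) j)%R| <= 1)%N.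
Proof.
move=> /(_ j); rewrite -/(occ j _); case: (scount_count j U) => -> _.
case: (scount_count j (A ++ U ++ V)) => _ ->.
by rewrite /half_scount !count_cat; lia.
Qed.

Lemma gap_scount (k : nat) (m : 'I_k -> int) (i : 'I_k) (e e' : bool)
    (A U V : word (eq_symbol k)) (W := A ++ (inl i, e) :: U ++ (inl i, e') :: V) :
  quadratic W -> occ i U = 0%N ->
  (if e == e' then if e then m i else - m i else 0) = half_scount W i * m i.
Proof.
move=> qW U0; have [WE _] := scount_sign i qW; move: WE.
have : occ i W = 2%N := qW i.
rewrite /scount /W !height_cat !height_cons !height_cat !height_cons.
rewrite -!/(scount _ _) (scount0 U0) !(occ_cat, occ_cons) /= U0 eqxx => cW.
have A0 : occ i A = 0%N by lia.
have V0 : occ i V = 0%N by lia.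
rewrite (scount0 A0) (scount0 V0) /letter_height /= eqxx.
set t := half_scount _ _ => WE; clearbody t.
have -> : t = (if e == e' then if e then 1 else -1 else 0).
  by move: WE; clear; case: e; case: e'; rewrite /=; lia.
by clear; case: e; case: e' => /=; lia.
Qed.

Lemma height_const_le (k : nat) (w : word (eq_symbol k)) :
  (`|height (sym_height (fun=> 0)) w| <= size w)%N.
Proof.
elim: w => [|l w IH]; first by rewrite height_nil.
rewrite height_cons /= (leq_trans (absz_add_le _ _)) // -add1n leq_add //.
by case: l => [[j|[]] []].
Qed.

(** The height equation reads h + 2 sum_j half_scount_j m_j = 0 with h the
    height of the constants.  Subtracting half of it from the gap turns the
    coefficient of m_j into scount_j U - half_scount_j, which lies in
    {-1, 0, 1} by [scount_infix], and cancels the coefficient of m_i, so that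
    m_i remains free for solving the height equation.  The solution m0 is only
    used to see that h is even. *)
Lemma gap_affine (k : nat) (i : 'I_k) (e e' : bool)
    (A U V : word (eq_symbol k)) (W := A ++ (inl i, e) :: U ++ (inl i, e') :: V)
    (m0 : 'I_k -> int) :
  quadratic W -> occ i U = 0%N ->
  height (sym_height m0) W = 0 ->
  exists beta : int, exists2 B : 'I_k -> int,
    (`|beta| <= 2 * size W)%N /\ (forall j, `|B j| <= 1)%N &
    forall m, height (sym_height m) W = 0 ->
      gap m i e e' U = beta + \sum_(j | j != i) m j * B j.
Proof.
move=> qW U0 hW.
have tE j := (scount_sign j qW).1.
pose b := height (sym_height (fun=> 0)) U.
pose h := height (sym_height (fun=> 0)) W.
have hE m : height (sym_height m) W = h + 2 * \sum_j m j * half_scount W j.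
  rewrite height_scount -/h mulr_sumr; congr (_ + _).
  by apply: eq_bigr => j _; rewrite tE; ring.
(* The height equation at m0 gives h = - 2 c. *)
pose c := \sum_j m0 j * half_scount W j.
exists (b + c), (fun j => scount j U - half_scount W j).
  split.
    have := hE m0; rewrite hW -/c => hc.
    have := height_const_le U; have := height_const_le W; rewrite -/h -/b.
    by rewrite /W !size_cat /= !size_cat /=; lia.
  move=> j; have WE : W = (A ++ [:: (inl i, e)]) ++ U ++ (inl i, e') :: V.
    by rewrite -catA.
  by rewrite WE; apply: scount_infix; rewrite -WE.
move=> m hm; rewrite /gap (@gap_scount _ m i e e' A U V) // -/W height_scount -/b.
have := hE m; rewrite hm; have := hE m0; rewrite hW -/c => h1 h2.
have -> : c = m i * half_scount W i + \sum_(j | j != i) m j * half_scount W j.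
  by transitivity (\sum_j m j * half_scount W j); [lia | rewrite (bigD1 i)].
rewrite (bigD1 i) //= (scount0 U0) mulr0 add0r.
have -> : \sum_(j | j != i) m j * scount j U =
   \sum_(j | j != i) m j * half_scount W j +
   \sum_(j | j != i) m j * (scount j U - half_scount W j).
  by rewrite -big_split /=; apply: eq_bigr => j _; ring.
ring.
Qed.

Lemma height_sum_le (k : nat) (m : 'I_k -> int) (i : 'I_k) (D M : nat)
    (w : word (eq_symbol k)) :
  (0 < D)%N -> (forall j, j != i -> `|m j| <= D)%N -> (`|m i| <= D + M)%N ->
  (\sum_(l <- w) `|letter_height (sym_height m) l| <=
   size w * D + occ i w * M)%N.
Proof.
move=> D0 mD miD; elim: w => [|[s b] w IH]; first by rewrite big_nil.
rewrite big_cons occ_cons.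
have -> : `|letter_height (sym_height m) (s, b)|%N = `|sym_height m s|%N.
  by case: b; rewrite /letter_height //= abszN.
rewrite /= mulSn mulnDl addnACA leq_add //.
case: s => [j|[]] /=; [|lia|lia].
rewrite (inj_eq (@inl_inj _ _)); have [->|ji] := eqVneq j i; first by rewrite mul1n.
by rewrite mul0n addn0 mD.
Qed.

(** All heights except that of z_i can be prescribed.  If the exponents of z_i
    agree, the height equation then determines m_i, and by linearity the
    congruences that hold for the other heights are inherited; if no variable
    has equal exponents, the equation imposes nothing. *)
Lemma choose_heights (k : nat) (W : word (eq_symbol k)) (i : 'I_k)
    (m f : 'I_k -> int) (D : nat) :
  quadratic W -> (0 < D)%N -> height (sym_height m) W = 0 ->
  (half_scount W i != 0 \/ forall j, half_scount W j = 0) ->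
  (forall j, `|f j| <= D)%N ->
  exists2 m' : 'I_k -> int, height (sym_height m') W = 0 &
    [/\ forall j, j != i -> m' j = f j,
        forall d : int, (forall j, d %| m j - f j)%Z -> forall j, (d %| m j - m' j)%Z
      & (\sum_(l <- W) `|letter_height (sym_height m') l| <=
         size W * D + 2 * (size W + size W * D))%N].
Proof.
move=> qW D0 hW ti fD.
have tE j := (scount_sign j qW).1.
pose h := height (sym_height (fun=> 0)) W.
have hE m1 : height (sym_height m1) W = h + 2 * \sum_j m1 j * half_scount W j.
  rewrite height_scount -/h mulr_sumr; congr (_ + _).
  by apply: eq_bigr => j _; rewrite tE; ring.
have hle := height_const_le W; rewrite -/h in hle.
have kW := quadratic_vars qW.
case: (eqVneq (half_scount W i) 0) ti => [t0 [//|t_all]|tn0 _].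
  exists f; last split=> //.
    move: hW; rewrite !hE.
    by rewrite !big1 // => j _; rewrite t_all mulr0.
  apply: leq_trans (@height_sum_le _ f i D 0 W D0 _ _) _ => //; first by rewrite addn0.
  by rewrite muln0 leq_add2l.
pose s := half_scount W i.
have ss : s * s = 1.
  by have := (scount_sign i qW).2; rewrite -/s; move: tn0; rewrite -/s; nia.
pose m' j := if j == i then
  m i + s * \sum_(j' | j' != i) half_scount W j' * (m j' - f j') else f j.
have m'i : m' i = m i + s * \sum_(j' | j' != i) half_scount W j' * (m j' - f j').
  by rewrite /m' eqxx.
have m'f j : j != i -> m' j = f j by rewrite /m' => /negbTE ->.
have hm' : height (sym_height m') W = 0.
  rewrite -hW !hE; congr (_ + 2 * _); rewrite (bigD1 i) //= [RHS](bigD1 i) //= m'i.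
  rewrite -/s; set S := \sum_(j' | _) half_scount W j' * _.
  have -> : (m i + s * S) * s = m i * s + S.
    by rewrite -[X in _ = _ + X]mul1r -ss; ring.
  rewrite -addrA; congr (_ + _); rewrite -big_split /=; apply: eq_bigr => j ji.
  by rewrite m'f //; ring.
exists m' => //; split=> //.
  move=> d hd j; case: (eqVneq j i) => [->|ji]; last by rewrite m'f.
  rewrite m'i opprD addrA subrr sub0r rpredN dvdz_mull // rpred_sum // => j' _.
  by rewrite dvdz_mull.
have <- : occ i W = 2%N := qW i; apply: height_sum_le => //.
  by move=> j ji; rewrite m'f.
have SB : (`|(\sum_(j | j != i) f j * half_scount W j)%R| <= k * D)%N.
  rewrite -[X in (_ <= X * _)%N]card_ord -sum_nat_const.
  rewrite [X in (_ <= X)%N](bigID (fun j => j != i)) /= -[X in (X <= _)%N]addn0.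
  apply: leq_add => //.
  elim/big_ind2 : _ => // [a b c d' h1 h2|j _].
    exact: leq_trans (absz_add_le _ _) (leq_add h1 h2).
  by rewrite abszM -[D]muln1 leq_mul //; case: (scount_sign j qW).
have := hE m'; rewrite hm' (bigD1 i) //= -/s.
rewrite (eq_bigr (fun j => f j * half_scount W j)); last by move=> j ji; rewrite m'f.
move: SB; set S := \sum_(j | _) _ => SB hh.
have s1 : s = 1 \/ s = -1 by move: ss; nia.
have : (k * D <= size W * D)%N by rewrite leq_mul2r; lia.
by case: s1 hh => ->; lia.
Qed.

(** * Coefficients that divide n^D - 1 *)

(** Collects the constants of [solves_mod] for D <= 4 L and heights at most
    14 L^2, where L is the length of the equation. *)
Definition size_constant (n : int) : nat := (33 * (`|n| + 2) + 81)%N.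

Definition bounded_solution (n : int) (k : nat) (W : word (eq_symbol k)) : Prop :=
  exists2 g : k.-tuple (BS n), is_solution W g
    & (solution_size g <= size_constant n * size W ^ 3)%N.

Lemma bounded_of_solves (n : int) (k : nat) (W : word (eq_symbol k))
    (m : 'I_k -> int) (x : 'I_k -> rat) (B M : nat) :
  n <> 0 -> quadratic W -> solves n W m x -> (forall i, reachable n B (x i)) ->
  (forall i, `|m i| <= M)%N -> (B + M <= size_constant n * size W ^ 2)%N ->
  bounded_solution n W.
Proof.
move=> n0 qW sol xB mM BM.
have [g gS gB] := solution_of_solves n0 sol xB mM.
exists g => //; apply: leq_trans gB _; rewrite expnSr mulnA mulnC leq_mul //.
by have := quadratic_vars qW; lia.
Qed.

Lemma var_height_le (k : nat) (W : word (eq_symbol k)) (m : 'I_k -> int) (i : 'I_k) :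
  quadratic W ->
  (`|m i| <= \sum_(l <- W) `|letter_height (sym_height m) l|)%N.
Proof.
move=> /(quadraticP i) [A e U e' V -> _ _ _].
rewrite big_cat big_cons /= addnCA -[X in (X <= _)%N]addn0 leq_add //.
by rewrite /letter_height; case: e => //=; rewrite abszN.
Qed.

Lemma bounded_of_mod (n : int) (k : nat) (W : word (eq_symbol k))
    (m m' : 'I_k -> int) (x : 'I_k -> rat) (i0 : 'I_k) (D : nat) (Q v e : int) :
  n <> 0 -> quadratic W -> (0 < D <= 4 * size W)%N -> Q <> 0 ->
  (Q %| n ^+ D - 1)%Z ->
  solves n W m x -> (forall i, in_ideal n 1 (x i)) ->
  (forall i, D %| m i - m' i)%Z ->
  height (sym_height m') W = 0 ->
  coef n m' i0 W * v%:~R = n%:~R ^ e * Q%:~R ->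
  (\sum_(l <- W) `|letter_height (sym_height m') l| <= 14 * size W ^ 2)%N ->
  (`|Q| <= 2 * `|n| ^ D)%N -> (`|v| <= `|n|)%N -> (`|e| <= 14 * size W ^ 2 + D)%N ->
  bounded_solution n W.
Proof.
move=> n0 qW /andP [D0 DW] Q0 hQ sol xI mD hW' cE HB QB vB eB.
have [x' sol' x'B] := solves_mod n0 D0 Q0 hQ sol xI mD hW' cE HB QB vB eB.
apply: (bounded_of_solves n0 qW sol' x'B (M := (14 * size W ^ 2)%N)).
  by move=> i; apply: leq_trans (var_height_le m' i qW) HB.
have L1 : (1 <= size W)%N by move: D0 DW; lia.
rewrite /size_constant; move: (size W) L1 DW => L L1 DW.
have LL : (L <= L ^ 2)%N by rewrite -{1}[L]muln1 expnS expn1 leq_mul.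
move: (`|n|%N) => a.
move: (L ^ 2)%N LL => P LL; nia.
Qed.

(** The exponent D for which n^D = 1 modulo the coefficient of a variable with
    gap G: n^G + 1 divides n^(2 G) - 1, whereas n^G - 1 needs only D = G.  The
    exponent 1 at G = 0 is meant for equal exponents, where the coefficient 2
    divides n - 1 if n is odd, and is a unit of Z[1/n] if n is even. *)
Definition gap_exponent (same : bool) (G : int) : nat :=
  if G == 0 then 1%N else if same then (2 * `|G|)%N else `|G|%N.

Lemma modulus_of_gap (n : int) (k : nat) (i : 'I_k) (e e' : bool)
    (A U V : word (eq_symbol k)) (W := A ++ (inl i, e) :: U ++ (inl i, e') :: V)
    (m : 'I_k -> int) (H : nat) (D := gap_exponent (e == e') (gap m i e e' U)) :
  (1 < `|n|)%N -> occ i A = 0%N -> occ i U = 0%N -> occ i V = 0%N ->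
  (e == e') || (gap m i e e' U != 0) ->
  (\sum_(l <- W) `|letter_height (sym_height m) l| <= H)%N ->
  exists Q v c : int, [/\ Q <> 0, (Q %| n ^+ D - 1)%Z,
    coef n m i W * v%:~R = n%:~R ^ c * Q%:~R,
    (`|Q| <= 2 * `|n| ^ D)%N & (`|v| <= `|n|)%N /\ (`|c| <= H + D)%N].
Proof.
move=> n1 A0 U0 V0 hG HB.
have n0 : n <> 0 by move=> E; rewrite E in n1.
have N0 := intr_neq0 n0.
pose p := - height (sym_height m) A + if e then 0 else m i.
have pH : (`|p| <= H)%N.
  apply: leq_trans HB; rewrite /p; case: (e) @W => W.
    rewrite addr0 abszN.
    have -> : A = take (size A) W by rewrite take_size_cat.
    exact: prefix_height_le.
  have -> : - height (sym_height m) A + m i = - height (sym_height m) (take (size A).+1 W).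
    rewrite /W -cat_rcons -[(size A).+1](size_rcons A (inl i, false)) take_size_cat //.
    by rewrite -cats1 height_cat height_cons height_nil /letter_height /=; ring.
  by rewrite abszN; apply: prefix_height_le.
have := coef_gap m e e' n0 A0 U0 V0; rewrite -/W -/p.
pose s : int := if e then 1 else -1.
have -> : (if e then 1 else -1 : rat) = s%:~R by rewrite /s; case: (e).
have ss : s%:~R * s%:~R = 1 :> rat by rewrite /s; case: (e).
have s1 : (`|s| = 1)%N by rewrite /s; case: (e).
move: hG @D; set G := gap _ _ _ _ _.
clearbody s p G; clear HB => hG D ->.
have nD : forall d, (`|n| ^ d > 0)%N by move=> d; rewrite expn_gt0; apply/orP; left; lia.
rewrite /D /gap_exponent; case: (eqVneq G 0) hG => [-> | G0 _]; rewrite ?orbF.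
  move=> -> {D}; rewrite oppr0 expr0z.
  case: (boolP (2 %| n)%Z) => [/dvdzP [h hE]|n_odd].
    exists 1, (s * h), (p + 1); split=> //.
    - have hN : n%:~R = h%:~R * 2%:~R :> rat by rewrite {1}hE intrM.
      rewrite expfzDr // expr1z mulr1 intrM [X in _ = _ * X]hN.
      have -> : n%:~R ^ p * s%:~R * (1 + 1) * (s%:~R * h%:~R) =
        n%:~R ^ p * (s%:~R * s%:~R) * (h%:~R * 2%:~R) :> rat by ring.
      by rewrite ss mulr1.
    - by rewrite expn1; lia.
    by split; [rewrite abszM s1 mul1n; lia | lia].
  exists 2, s, p; split=> //.
  - by rewrite expr1; lia.
  - have -> : n%:~R ^ p * s%:~R * (1 + 1) * s%:~R =
        n%:~R ^ p * (s%:~R * s%:~R) * 2%:~R :> rat by ring.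
    by rewrite ss mulr1.
  - by rewrite expn1; lia.
  by split; lia.
case: ifP => _ {D}.
  pose E := `|G|%N; rewrite -/E.
  have E0 : (0 < E)%N by rewrite /E absz_gt0.
  have nE2 : (1 < `|n| ^ E)%N by rewrite -{1}(expn0 `|n|) ltn_exp2l.
  exists (n ^+ E + 1), s, (if 0 < G then p - E%:Z else p); split.
  - by move=> /eqP; rewrite addr_eq0 => /eqP /(congr1 absz); rewrite abszN abszX; lia.
  - by apply/dvdzP; exists (n ^+ E - 1); rewrite mulnC exprM; ring.
  - have -> : n%:~R ^ p * s%:~R * (1 + n%:~R ^ (- G)) * s%:~R =
        n%:~R ^ p * (s%:~R * s%:~R) * (1 + n%:~R ^ (- G)) :> rat by ring.
    rewrite ss mulr1 intrD rmorphXn /= exprnP.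
    case: ifP => Gs; last by rewrite addrC; congr (_ * (_ ^ _ + _)); rewrite /E; lia.
    rewrite [in RHS]expfzDr // -mulrA; congr (_ * _).
      rewrite mulrDr -expfzDr // addNr expr0z mulr1.
    by congr (_ + _ ^ _); rewrite /E; lia.
  - apply: leq_trans (absz_add_le _ _) _; rewrite abszX.
    have : (`|n| ^ E <= `|n| ^ (2 * E))%N by rewrite leq_pexp2l; lia.
    by have := nD E; rewrite absz1; lia.
  by split; [lia | case: ifP => _; lia].
pose E := `|G|%N; rewrite -/E.
have E0 : (0 < E)%N by rewrite /E absz_gt0.
have nE2 : (1 < `|n| ^ E)%N by rewrite -{1}(expn0 `|n|) ltn_exp2l.
exists (n ^+ E - 1), (if 0 < G then s else - s), (if 0 < G then p - E%:Z else p); split.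
- by move=> /eqP; rewrite subr_eq0 => /eqP /(congr1 absz); rewrite abszX; lia.
- by [].
- have -> : n%:~R ^ p * s%:~R * (1 - n%:~R ^ (- G)) * (if 0 < G then s else - s)%:~R =
      n%:~R ^ p * (s%:~R * s%:~R) * (if 0 < G then 1 - n%:~R ^ (- G) else n%:~R ^ (- G) - 1) :> rat.
    by case: ifP => _; rewrite ?intrN; ring.
  rewrite ss mulr1 intrB rmorphXn /= exprnP.
  case: ifP => Gs; last by congr (_ * (_ ^ _ - _)); rewrite /E; lia.
  rewrite [in RHS]expfzDr // -mulrA; congr (_ * _).
      rewrite mulrBr -expfzDr // addNr expr0z mulr1.
  by congr (_ - _ ^ _); rewrite /E; lia.
- apply: leq_trans (absz_add_le _ _) _; rewrite abszX abszN absz1.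
  by have := nD E; lia.
by split; [case: ifP; lia | case: ifP => _; lia].
Qed.

(** * Equations with a nonconstant or nonzero gap *)

Lemma modz_residue_le (a : int) (D : nat) :
  (0 < D)%N -> (`|(a %% D)%Z| <= D)%N.
Proof.
move=> D0; have D0' : D%:Z != 0 by lia.
by have := modz_ge0 a D0'; have := ltz_mod a D0'; lia.
Qed.

Lemma dvd_sub_modz (a : int) (D : nat) : (D %| a - (a %% D)%Z)%Z.
Proof. by rewrite {1}(divz_eq a D) addrK dvdz_mull. Qed.

(** If the gap of z_i varies with some other height m_j, that height alone can
    bring it to the target 0 (equal exponents) or 1 (different exponents),
    for which D = 1, so that no congruence constrains the new heights.
    Otherwise the gap is the same for all admissible heights, and reducing
    them modulo D is harmless. *)
Lemma bounded_or_trivial (n : int) (k : nat) (i : 'I_k) (e e' : bool)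
    (A U V : word (eq_symbol k)) (W := A ++ (inl i, e) :: U ++ (inl i, e') :: V)
    (m : 'I_k -> int) (x : 'I_k -> rat) :
  (1 < `|n|)%N -> quadratic W ->
  occ i A = 0%N -> occ i U = 0%N -> occ i V = 0%N ->
  (half_scount W i != 0 \/ forall j, half_scount W j = 0) ->
  solves n W m x -> (forall i, in_ideal n 1 (x i)) ->
  bounded_solution n W \/ e != e' /\ gap m i e e' U = 0.
Proof.
move=> n1 qW A0 U0 V0 ti sol xI.
have n0 : n <> 0 by move=> E; rewrite E in n1.
have L2 : (2 <= size W)%N by rewrite /W size_cat /= size_cat /=; lia.
have [beta [B [betaB BB] gapE]] := gap_affine qW U0 sol.1.
rewrite -/W in betaB.
(* The gap aimed at when it can be adjusted. *)
pose G0 : int := if e == e' then 0 else 1.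
have finish (f : 'I_k -> int) (G : int) (D := gap_exponent (e == e') G) :
    (forall j, (`|f j| <= 4 * size W)%N) -> (e == e') || (G != 0) ->
    (D <= 4 * size W)%N -> (forall j, D %| m j - f j)%Z ->
    (forall m', height (sym_height m') W = 0 ->
       (forall j, j != i -> m' j = f j) -> gap m' i e e' U = G) ->
    bounded_solution n W.
  move=> fB hG DW hD hgap.
  have LW : (0 < 4 * size W)%N by lia.
  have [m' hm' [m'f m'D m'B]] := choose_heights qW LW sol.1 ti fB.
  have m'B' : (\sum_(l <- W) `|letter_height (sym_height m') l| <= 14 * size W ^ 2)%N.
    apply: leq_trans m'B _; move: L2; rewrite -!/W; move: (size W) => L L2.
    by rewrite expnS expn1; nia.
  have gG := hgap m' hm' m'f.
  have [|Q [v [c [Q0 hQ cE QB [vB cB]]]]] :=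
    @modulus_of_gap n k i e e' A U V m' (14 * size W ^ 2)%N n1 A0 U0 V0 _ m'B'.
    by rewrite gG.
  rewrite gG -/D in hQ QB cB.
  apply: (bounded_of_mod n0 qW _ Q0 hQ sol xI (m'D D hD) hm' cE m'B' QB vB cB).
  rewrite DW andbT /D /gap_exponent; case: (eqVneq G 0) => // G0'.
  by case: ifP => _; lia.
have [/existsP [j /andP [ji Bj]]|Bnone] := boolP [exists j, (j != i) && (B j != 0)].
  left; apply: (finish (fun j' => if j' == j then B j * (G0 - beta) else 0) G0).
  - move=> j'; case: eqP => // _; rewrite abszM.
    have h : (`|(G0 - beta)%R| <= 1 + `|beta|)%N by rewrite /G0; case: ifP; lia.
    by apply: leq_trans (leq_mul (BB j) h) _; rewrite mul1n; lia.
  - by rewrite /G0; case: ifP.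
  - by rewrite /gap_exponent /G0; case: (e == e') => /=; lia.
  - by move=> j'; rewrite /gap_exponent /G0; case: (e == e'); rewrite /= dvd1z.
  move=> m' hm' m'f; rewrite gapE // (bigD1 j) //= m'f // eqxx big1 ?addr0.
    have BBj : B j * B j = 1 by have := BB j; move: Bj; nia.
    by rewrite mulrC mulrA BBj; ring.
  by move=> j' /andP [j'i /negbTE j'j]; rewrite m'f // j'j mul0r.
have B0 j : j != i -> B j = 0.
  move=> ji; apply/eqP; move: Bnone; rewrite negb_exists => /forallP /(_ j).
  by rewrite ji negbK.
have gapb m' : height (sym_height m') W = 0 -> gap m' i e e' U = beta.
  by move=> hm'; rewrite gapE // big1 ?addr0 // => j /B0 ->; rewrite mulr0.
case hG : ((e == e') || (beta != 0)); last first.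
  right; move/negbT/norP: hG => [ee]; rewrite negbK => /eqP b0.
  by split=> //; rewrite (gapb _ sol.1).
left; pose D := gap_exponent (e == e') beta.
have D0 : (0 < D)%N.
  by rewrite /D /gap_exponent; case: (eqVneq beta 0) => // b0; case: ifP => _; lia.
have D4 : (D <= 4 * size W)%N.
  rewrite /D /gap_exponent.
  by case: (eqVneq beta 0) => [_|b0]; [|case: ifP => _]; lia.
apply: (finish (fun j => (m j %% D)%Z) beta) => //.
- by move=> j; apply: leq_trans D4; apply: modz_residue_le.
- by move=> j; apply: dvd_sub_modz.
by move=> m' hm' _; apply: gapb.
Qed.

Lemma exprz_pm1 (n z : int) :
  `|n|%N = 1%N -> n%:~R ^ z = 1 :> rat \/ n%:~R ^ z = -1 :> rat.
Proof.
move=> n1; have [->|->] : n = 1 \/ n = -1 by lia.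
  by left; rewrite exp1rz.
by rewrite intrN expN1r -signr_odd; case: (odd _); [right|left].
Qed.

(** Each coefficient is 0 or 2 up to sign, and depends only on the parities of
    the heights.  If all of them vanish, reducing the heights modulo 2 keeps the
    shift of the constants equal to 0, which is the congruence for Q = 0. *)
Lemma bounded_absz1 (n : int) (k : nat) (i : 'I_k) (W : word (eq_symbol k))
    (m : 'I_k -> int) (x : 'I_k -> rat) :
  `|n|%N = 1%N -> quadratic W ->
  (half_scount W i != 0 \/ forall j, half_scount W j = 0) ->
  solves n W m x -> (forall i, in_ideal n 1 (x i)) ->
  bounded_solution n W.
Proof.
move=> n1 qW ti sol xI; have n0 : n <> 0 by move=> E; rewrite E in n1.
have L2 : (2 <= size W)%N.
  case: (quadraticP i qW) => A e U e' V -> _ _ _.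
  by rewrite size_cat /= size_cat /=; lia.
have LW : (0 < 4 * size W)%N by lia.
have fB j : (`|(m j %% 2%N)%Z| <= 4 * size W)%N.
  by apply: leq_trans (modz_residue_le (m j) (isT : 0 < 2)%N) _; lia.
have [m' hm' [_ /(_ 2%N) m'D m'B]] := choose_heights qW LW sol.1 ti fB.
have {}m'D := m'D (fun j => dvd_sub_modz (m j) 2).
have m'B' : (\sum_(l <- W) `|letter_height (sym_height m') l| <= 14 * size W ^ 2)%N.
  apply: leq_trans m'B _; move: L2; move: (size W) => L L2.
  by rewrite expnS expn1; nia.
have [/existsP [j cj]|cnone] := boolP [exists j, coef n m' j W != 0].
  have [s sE s1] : exists2 s : int, coef n m' j W * s%:~R = 2 & (`|s| = 1)%N.
    move: cj; case: (quadraticP j qW) => A e U e' V -> A0 U0 V0.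
    rewrite coef_gap //; set p := _ + _; set G := gap _ _ _ _ _; clearbody p G.
    have [->|->] := exprz_pm1 p n1; have [->|->] := exprz_pm1 (- G) n1;
      case: e; case: e' => /=; rewrite ?subrr ?addrN ?mulr0 ?eqxx // => _;
      first [by exists 1; [ring|] | by exists (-1); [ring|] ].
  apply: (@bounded_of_mod n k W m m' x j 2 2 s 0 n0 qW _ _ _ sol xI m'D hm' _ m'B').
  - by lia.
  - by [].
  - by have [->|->] : n = 1 \/ n = -1 by lia.
  - by rewrite sE expr0z mul1r.
  - by rewrite n1.
  - by rewrite s1 n1.
  - by [].
have c0 j : coef n m' j W = 0.
  by apply/eqP; move: cnone; rewrite negb_exists => /forallP /(_ j); rewrite negbK.
have [z [e zE]] : in_ideal n 0 (0 - shift n%:~R (sym_height m') (sym_shift x) W).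
  rewrite -sol.2; apply: (shift_congr (D := 2) W n0 _ _ _ _).1.
  - by have [->|->] : n = 1 \/ n = -1 by lia.
  - by case=> [j|c] //=; rewrite subrr dvdz0.
  - by case=> [j|[]] //=; [exact: (in_ideal_int n 1) | exact: (in_ideal_int n 0)].
  - by move=> s; rewrite subrr; apply: in_ideal_dvd (dvdz0 _).
apply: (bounded_of_solves (m := m') (x := fun=> 0) (B := 0) (M := (14 * size W ^ 2)%N) n0 qW).
- split=> //; apply/eqP; rewrite -oppr_eq0; move: zE; rewrite mul0r mul0r sub0r.
  by rewrite shift_coef big1 ?addr0 => [->|j _]; rewrite ?c0 ?mulr0.
- by move=> j; apply: reachable0.
- by move=> j; apply: leq_trans (var_height_le m' j qW) m'B'.
by rewrite add0n leq_mul // /size_constant; lia.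
Qed.

(** * Equations in which all coefficients vanish *)

(** By pigeonhole: each of the L + 1 values h j rules out the L + 1 shifts w
    that would send it to one of the residues 0, ..., L. *)
Lemma modz_window (L : nat) (h : nat -> int) (D := (L.+1 ^ 2).+1) :
  exists w : int, forall j, (j <= L)%N -> L%:Z < ((h j - w) %% D)%Z.
Proof.
pose bad := [seq `|((h j - r%:Z) %% D)%Z|%N | j <- iota 0 L.+1, r <- iota 0 L.+1].
have [w wD wbad] : exists2 w, (w < D)%N & w \notin bad.
  have [/hasP [w]|/hasPn all_bad] := boolP (has (fun w => w \notin bad) (iota 0 D)).
    by rewrite mem_iota => /andP [_ wD] wbad; exists w.
  have : (D <= size bad)%N.
    rewrite -[X in (X <= _)%N](size_iota 0) uniq_leq_size ?iota_uniq // => w wD.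
    by move: (all_bad w wD); rewrite negbK.
  by rewrite size_allpairs !size_iota /D expnS expn1 ltnn.
have D0 : D%:Z != 0 by [].
exists w => j jL; rewrite ltNge; apply: contra wbad => small.
have r0 := modz_ge0 (h j - w%:Z) D0.
apply/allpairsP; exists (j, `|((h j - w%:Z) %% D)%Z|%N).
split; [by rewrite mem_iota /= add0n ltnS | by rewrite mem_iota /= add0n ltnS; lia |].
rewrite /= gez0_abs //.
have -> : ((h j - ((h j - w%:Z) %% D)%Z) %% D = w%:Z %% D)%Z.
  apply/eqP; rewrite eqz_mod_dvd.
  have -> (a b c : int) : a - b - c = (a - c) - b by ring.
  exact: dvd_sub_modz.
by rewrite modz_small.
Qed.

Lemma cat_first_occurrence (T : Type) (p : pred T) (A X P R : seq T) (l l' : T) :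
  p l -> p l' -> count p A = 0%N -> A ++ l :: X = P ++ l' :: R ->
  [/\ P = A, l' = l & R = X] \/
  exists2 P', P = A ++ l :: P' & X = P' ++ l' :: R.
Proof.
move=> pl pl'; elim: A P => [|a A IH] [|b P] /=.
- by move=> _ [-> ->]; left.
- by move=> _ [-> ->]; right; exists P.
- by case: (boolP (p a)) => // pa _ [E]; rewrite E pl' in pa.
case: (boolP (p a)) => // _; rewrite add0n => A0 [<-] /(IH _ A0).
by case=> [[-> -> ->]|[P' -> ->]]; [left | right; exists P'].
Qed.

(** When all gaps are 0 and exponents differ, the two occurrences of z_i run
    between the same two heights in opposite directions.  So any relabelling
    phi of the heights still gives both occurrences one common height
    difference, and only its compatibility with the letters t has to be
    required. *)
Lemma reheight (k : nat) (W : word (eq_symbol k)) (m : 'I_k -> int)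
    (phi : int -> int) :
  quadratic W ->
  (forall i A e U e' V, W = A ++ (inl i, e) :: U ++ (inl i, e') :: V ->
     occ i A = 0%N -> occ i U = 0%N -> occ i V = 0%N ->
     e != e' /\ gap m i e e' U = 0) ->
  (forall P b R, W = P ++ (inr gen_t, b) :: R ->
     let h := height (sym_height m) P in
     phi (h + if b then 1 else -1) = phi h + if b then 1 else -1) ->
  exists2 m' : 'I_k -> int,
    forall P R, W = P ++ R ->
      height (sym_height m') P = phi (height (sym_height m) P) - phi 0 &
    forall i, exists y z : int, m' i = phi z - phi y /\ m i = z - y.
Proof.
move=> qW trivial_gap step.
have /fin_all_exists [m' m'P] (i : 'I_k) : exists v : int,
    (forall P b R, W = P ++ (inl i, b) :: R ->
      let h := height (sym_height m) P in
      phi (h + if b then m i else - m i) = phi h + if b then v else - v) /\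
    exists y z : int, v = phi z - phi y /\ m i = z - y.
  have [A e U e' V WE A0 U0 V0] := quadraticP i qW.
  have [ee' gap0] := trivial_gap _ _ _ _ _ _ WE A0 U0 V0.
  rewrite /gap (negbTE ee') addr0 in gap0.
  set hA := height (sym_height m) A.
  exists (if e then phi (hA + m i) - phi hA else phi hA - phi (hA - m i)); split.
    move=> P b R; rewrite WE.
    case/(cat_first_occurrence (p := fun l => l.1 == inl i) _ _ A0); rewrite ?eqxx //.
      by case=> -> [->] _ /=; rewrite -/hA; case: (e); ring.
    move=> [P' -> /(cat_first_occurrence (p := fun l => l.1 == inl i) _ _ U0)].
    rewrite /= eqxx; case=> //.
      case=> -> [->] _; rewrite height_cat height_cons gap0 addr0 -/hA /letter_height /=.
      by case: (e) (e') ee' => [] [] // _ /=; rewrite ?addrK ?subrK; ring.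
    (* A third occurrence would lie in V. *)
    case=> P'' _ VE; move: V0; rewrite VE occ_cat occ_cons /= eqxx; lia.
  case: (e); first by exists hA, (hA + m i); split=> //; ring.
  by exists (hA - m i), hA; split=> //; ring.
exists m'; last by move=> i; case: (m'P i).
elim/last_ind => [|P l IH] R; first by rewrite !height_nil subrr.
rewrite cat_rcons => WE; rewrite -cats1 !height_cat (IH _ WE) !height_cons !height_nil !addr0.
case: l WE => [[i|[]] b] WE; rewrite /letter_height /=.
- have [/(_ _ _ _ WE) /= -> _] := m'P i; ring.
- by rewrite oppr0 if_same !addr0.
by have /= -> := step _ _ _ WE; ring.
Qed.

(** The heights become residues modulo D that exceed L, so they have spread at
    most D - L - 2.  Up to a power of n, the shift of the constants is then an
    integer of absolute value at most L |n|^(D-L-2) and a multiple of n^D - 1,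
    hence 0.  No letter t crosses from residue D - 1 to residue 0,
    because prefixes avoid the residue 0. *)
Lemma bounded_of_trivial_gaps (n : int) (k : nat) (W : word (eq_symbol k))
    (m : 'I_k -> int) (x : 'I_k -> rat) :
  (1 < `|n|)%N -> quadratic W -> (0 < size W)%N -> solves n W m x ->
  (forall i A e U e' V, W = A ++ (inl i, e) :: U ++ (inl i, e') :: V ->
     occ i A = 0%N -> occ i U = 0%N -> occ i V = 0%N ->
     e != e' /\ gap m i e e' U = 0) ->
  bounded_solution n W.
Proof.
move=> n1 qW W0 [hW sW] trivial_gap.
have n0 : n <> 0 by move=> E; rewrite E in n1.
have N0 := intr_neq0 n0.
set L := size W in W0; pose D := (L.+1 ^ 2).+1.
have D0 : D%:Z != 0 by [].
have [w wP] := modz_window L (fun j => height (sym_height m) (take j W)).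
pose phi (y : int) : int := ((y - w) %% D)%Z.
have phi_lt y : 0 <= phi y < D by rewrite /phi modz_ge0 //= ltz_pmod.
have phi_prefix P R : W = P ++ R -> (L%:Z < phi (height (sym_height m) P)).
  move=> WE; have := wP (size P); rewrite WE take_size_cat //; apply.
  by rewrite /L WE size_cat leq_addr.
have phi_congr y z : (D %| (z - y) - (phi z - phi y))%Z.
  have -> : (z - y) - (phi z - phi y) = (z - w - phi z) - (y - w - phi y) by ring.
  by rewrite rpredB // dvd_sub_modz.
clearbody phi.
have phi_succ y : 0 < phi (y + 1) -> phi (y + 1) = phi y + 1.
  move=> pos; have /dvdzP [q qE] := phi_congr y (y + 1).
  have := phi_lt y; have := phi_lt (y + 1) => b1 b2.
  have : q = 0 by nia.
  by move=> q0; move: qE; rewrite q0 mul0r; lia.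
have [m' m'h m'v] : exists2 m' : 'I_k -> int,
    forall P R, W = P ++ R ->
      height (sym_height m') P = phi (height (sym_height m) P) - phi 0 &
    forall i, exists y z : int, m' i = phi z - phi y /\ m i = z - y.
  apply: reheight => // P b R WE /=; set h := height _ P.
  have h1 : (L%:Z < phi h) := phi_prefix _ _ WE.
  have h2 : (L%:Z < phi (h + if b then 1 else -1)).
    have := phi_prefix (rcons P (inr gen_t, b)) R; rewrite cat_rcons => /(_ WE).
    by rewrite -cats1 height_cat height_cons height_nil addr0 -/h; case: (b).
  case: (b) h2 => /= h2; first by apply: phi_succ; apply: le_lt_trans h2.
  have -> : phi h = phi (h - 1) + 1.
    by rewrite -phi_succ; rewrite subrK //; apply: le_lt_trans h1.
  by rewrite addrK.
have hW' : height (sym_height m') W = 0.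
  by rewrite (m'h W [::]) ?cats0 // hW subrr.
have s0 : shift n%:~R (sym_height m) (sym_shift (fun=> 0)) W = 0.
  move: sW; rewrite shift_coef big1 ?addr0 // => i _.
  have [A e U e' V WE A0 U0 V0] := quadraticP i qW.
  have [ee' gap0] := trivial_gap _ _ _ _ _ _ WE A0 U0 V0.
  by rewrite WE coef_gap // gap0 (negbTE ee') oppr0 expr0z subrr !mulr0.
pose Q := n ^+ D - 1.
have sI : in_ideal n Q (shift n%:~R (sym_height m') (sym_shift (fun=> 0)) W).
  have c1 s : (D %| sym_height m s - sym_height m' s)%Z.
    case: s => [i|c] /=; last by rewrite subrr dvdz0.
    by have [y [z [-> ->]]] := m'v i.
  have c2 s : in_ideal n 1 (sym_shift (k := k) (fun=> 0) s).
    by case: s => [i|[]] /=;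
      [exact: (in_ideal_int n 0)|exact: (in_ideal_int n 1)|exact: (in_ideal_int n 0)].
  have c3 s : in_ideal n Q (sym_shift (k := k) (fun=> 0) s - sym_shift (fun=> 0) s).
    by rewrite subrr; apply: in_ideal_dvd (dvdz0 _).
  have [+ _] := shift_congr W n0 (dvdzz Q) c1 c2 c3.
  by rewrite s0 sub0r => /in_idealN; rewrite opprK.
have [z zE zB] : exists2 z : int,
    shift n%:~R (sym_height m') (sym_shift (fun=> 0)) W =
      z%:~R * n%:~R ^ (- (D%:Z - 1 - phi 0))
    & (`|z| <= size W * 1 * `|n| ^ `|((D%:Z - 1 - phi 0) - (L.+1%:Z - phi 0))%R|)%N.
  apply: (@shift_bound _ n _ _ (fun s => if s is inr gen_a then 1 else 0)) => //.
  - by case=> [i|[]].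
  - by case=> [i|[]].
  move=> j; have WE := esym (cat_take_drop j W); rewrite (m'h _ _ WE).
  have := phi_prefix _ _ WE; have := phi_lt (height (sym_height m) (take j W)).
  by set q := phi (height _ _); lia.
have z0 : z = 0.
  have /dvdzP [q qE] : (Q %| z)%Z.
    apply: (@ideal_int_dvd n Q z D n0 isT (dvdzz Q)).
    have -> : z%:~R = shift n%:~R (sym_height m') (sym_shift (fun=> 0)) W *
        n%:~R ^ (D%:Z - 1 - phi 0) :> rat.
      by rewrite zE -mulrA -expfzDr // addNr expr0z mulr1.
    by apply: in_idealM => //; apply: in_ideal_exp.
  have QB : (`|n| ^ D <= `|Q| + 1)%N by rewrite -abszX /Q; lia.
  have DL : (L.+1 < D)%N by rewrite /D ltnS expnS expn1 leq_pmulr.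
  have eE : (`|((D%:Z - 1 - phi 0) - (L.+1%:Z - phi 0))%R| = D - L.+2)%N by lia.
  rewrite eE muln1 -/L in zB.
  have zn : (`|z| <= `|n| ^ (D - 2))%N.
    apply: leq_trans zB _; have -> : (D - 2 = L + (D - L.+2))%N by lia.
    by rewrite expnD leq_mul // ltnW // ltn_expl.
  have nD : (`|n| ^ D = `|n| * (`|n| * `|n| ^ (D - 2)))%N.
    by rewrite -!expnS; congr (_ ^ _)%N; lia.
  have n2 : (0 < `|n| ^ (D - 2))%N by rewrite expn_gt0; apply/orP; left; lia.
  have zQ : (`|z| < `|Q|)%N.
    have : (2 * 2 * `|n| ^ (D - 2) <= `|n| ^ D)%N.
      by rewrite nD mulnA leq_mul2r leq_mul ?orbT.
    by move: QB zn n2; clear; lia.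
  case: (eqVneq q 0) => [q0|q0]; first by rewrite qE q0 mul0r.
  by move: zQ; rewrite qE abszM ltnNge leq_pmull // absz_gt0.
apply: (bounded_of_solves (m := m') (x := fun=> 0) (B := 0) (M := D) n0 qW).
- by split=> //; rewrite zE z0 mul0r.
- by move=> j; apply: reachable0.
- move=> i; have [y [z' [-> _]]] := m'v i.
  by have := phi_lt y; have := phi_lt z'; lia.
rewrite /size_constant /D -/L !expnS expn0 !muln1; nia.
Qed.

(** * The cubic bound *)

Lemma occ_sign (k : nat) (W : word (eq_symbol k)) (i : 'I_k) (e e' : bool)
    (A U V : word (eq_symbol k)) :
  quadratic W -> W = A ++ (inl i, e) :: U ++ (inl i, e') :: V -> occ i U = 0%N ->
  (e == e') = (half_scount W i != 0).
Proof.
move=> qW WE U0; move: qW; rewrite {1}WE => qW.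
have := @gap_scount k (fun=> 1) i e e' A U V qW U0; rewrite -WE mulr1 => <-.
by case: (e); case: (e').
Qed.

Theorem theorem1p3 (n : int) (n_neq0 : n <> 0%R) :
  exists C : nat,
    forall (k : nat) (W : word (eq_symbol k)),
      freely_reduced W ->
      quadratic W ->
      (exists g : k.-tuple (BS n), is_solution W g) ->
      exists2 g : k.-tuple (BS n),
        is_solution W g & (solution_size g <= C * size W ^ 3)%N.
Proof.
exists (size_constant n) => k W _ qW [g gS]; rewrite -/(bounded_solution n W).
have sol := solves_of_solution n_neq0 gS.
have xI (i : 'I_k) := BS_shift_in_ideal (tnth g i) n_neq0.
have [k0|kpos] := posnP k.
  exists g => //; rewrite /solution_size big1 // => -[i ik].
  by exfalso; move: (ik); rewrite k0.
pose i0 := Ordinal kpos.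
have [i ti] : exists i, half_scount W i != 0 \/ forall j, half_scount W j = 0.
  have [/existsP [i ti]|none] := boolP [exists i, half_scount W i != 0].
    by exists i; left.
  exists i0; right=> j; apply/eqP; move: none; rewrite negb_exists => /forallP /(_ j).
  by rewrite negbK.
have [n1|n1] : `|n|%N = 1%N \/ (1 < `|n|)%N.
- by have : `|n|%N != 0%N; [rewrite absz_eq0; apply/eqP | lia].
- exact: bounded_absz1 n1 qW ti sol xI.
have trivial_or i1 A e U e' V : (half_scount W i1 != 0 \/ forall j, half_scount W j = 0) ->
    W = A ++ (inl i1, e) :: U ++ (inl i1, e') :: V ->
    occ i1 A = 0%N -> occ i1 U = 0%N -> occ i1 V = 0%N ->
    bounded_solution n W \/ e != e' /\ gap (fun i => BS_height (tnth g i)) i1 e e' U = 0.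
  move=> ti1 WE A0 U0 V0; move: qW sol ti1; rewrite WE => qW' sol' ti1.
  exact: bounded_or_trivial n1 qW' A0 U0 V0 ti1 sol' xI.
have [bW|nbW] := EM (bounded_solution n W) => //.
have t0 j : half_scount W j = 0.
  case: ti => [ti|//]; case: nbW.
  have [A e U e' V WE A0 U0 V0] := quadraticP i qW.
  have [//|[]] := trivial_or _ _ _ _ _ _ (or_introl ti) WE A0 U0 V0.
  by rewrite (occ_sign qW WE U0) ti.
apply: (bounded_of_trivial_gaps n1 qW _ sol).
  by have := quadratic_vars qW; lia.
move=> i1 A e U e' V WE A0 U0 V0.
by have [//|] := trivial_or _ _ _ _ _ _ (or_intror t0) WE A0 U0 V0.
Qed.
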